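(* Let $a>1$, $c\in\mathbb{R}\setminus\{0\}$, and let $$M=\Bigl\{(z,w)\in(\mathbb{C}\cup\{\infty\})^2 \,\Big|\, w^2=\tfrac{(z+1)(z-a)}{(z-1)(z+a)}\Bigr\}\setminus\{(\infty,1),(\infty,-1)\}.$$ Let $f:M\to\mathbb{S}^3_1$ be a CMC $1$ face (well-defined on $M$) constructed from the Weierstrass data $G=w$, $Q=c\,dz\,dw/w$; that is, $f=Fe_3F^*$, where $F:\widetilde M\to SL(2,\mathbb{C})$ is a holomorphic solution on the universal cover $\widetilde M$ of $M$ of $$dF\cdot F^{-1}=\begin{pmatrix}G&-G^2\\1&-G\end{pmatrix}\frac{Q}{dG}=c\begin{pmatrix}1&-w\\ 1/w&-1\end{pmatrix}dz,$$ and all monodromy matrices of $F$ lie in $SU(1,1)$. Put $m=\sqrt{1-4c(a-1)}$. Then for each of the two ends $(\infty,1)$ and $(\infty,-1)$: (i) if $m\in\mathbb{R}^+\setminus\mathbb{N}$, the end is elliptic; (ii) if $m\in i\mathbb{R}\setminus\{0\}$, the end is hyperbolic.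
   Context: $M$ is a twice punctured torus; the two removed points are the ends. $\mathbb{S}^3_1=\{X\in M_2(\mathbb{C}) : X^*=X,\ \det X=-1\}=\{Fe_3F^* : F\in SL(2,\mathbb{C})\}$ is de Sitter $3$-space, with $e_3=\mathrm{diag}(1,-1)$ and $X^*$ the conjugate transpose. $SU(1,1)$ is the group of matrices $\begin{pmatrix}p&q\\\bar q&\bar p\end{pmatrix}$ with $|p|^2-|q|^2=1$. Monodromy: for a loop $\gamma$ in $M$ with associated deck transformation $\tau$ of $\widetilde M$, the monodromy matrix $\Phi_\gamma$ of $F$ is defined by $F\circ\tau=F\Phi_\gamma$. The map $f=Fe_3F^*$ is well-defined on $M$ if and only if $\Phi_\gamma\in SU(1,1)$ for all loops $\gamma$. The monodromy about an end is $\Phi_\gamma$ for a loop $\gamma$ in a small neighbourhood of the end winding once around it. An end is called elliptic if the monodromy matrix about it is conjugate in $SU(1,1)$ to $\begin{pmatrix}e^{i\theta}&0\\0&e^{-i\theta}\end{pmatrix}$ for some $\theta\in[0,2\pi)$, and hyperbolic if it is conjugate in $SU(1,1)$ to $\pm\begin{pmatrix}\cosh s&\sinh s\\\sinh s&\cosh s\end{pmatrix}$ for some $s\in\mathbb{R}\setminus\{0\}$. $m$ is a square root of the real number $1-4c(a-1)$, taken nonnegative when that number is nonnegative, and purely imaginary otherwise. $\mathbb{N}$ denotes the positive integers. *)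

(* Defs.v *)
From HB Require Import structures.
From mathcomp Require Import all_boot all_order all_algebra.
From mathcomp Require Import complex.
From mathcomp Require Import all_classical all_reals all_analysis.
Import numFieldNormedType.Exports.
Import Order.TTheory GRing.Theory Num.Theory.
Set Implicit Arguments.
Unset Strict Implicit.
Unset Printing Implicit Defensive.
Local Open Scope classical_set_scope.
Local Open Scope ring_scope.
Local Open Scope complex_scope.

(* The complex numbers [R[i]], with the topology of the modulus, as a
   one-dimensional normed module over themselves; [derivable g z 1] and
   [is_derive z 1 g d] then express complex differentiability. *)
HB.instance Definition _ (R : realType) := NormedModule.copy R[i] R[i]^o.

Section PathsAndCoverings.
Variable R : realType.
Local Notation unitI := (`[(0 : R), 1]%classic).

Definition is_path (T : topologicalType) (X : set T) (g : R -> T) : Prop :=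
  {within unitI, continuous g} /\ (forall t, unitI t -> X (g t)).

Definition is_loop (T : topologicalType) (X : set T) (g : R -> T) : Prop :=
  is_path X g /\ g 0 = g 1.

Definition null_homotopic (T : topologicalType) (g : R -> T) : Prop :=
  exists H : R * R -> T,
    [/\ {within unitI `*` unitI, continuous H},
        forall t, unitI t -> H (0, t) = g t,
        forall t, unitI t -> H (1, t) = g 0 &
        forall s, unitI s -> H (s, 0) = g 0 /\ H (s, 1) = g 0].

Definition simply_connected (T : topologicalType) : Prop :=
  (forall x y : T, exists g, [/\ is_path setT g, g 0 = x & g 1 = y]) /\
  (forall g : R -> T, is_loop setT g -> null_homotopic g).

(* The map [s] below is the inverse of the restriction of [p] to the sheet
   [V i]; its values outside [U] are irrelevant. *)
Definition evenly_covered (T B : topologicalType) (p : T -> B) (U : set B) :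
    Prop :=
  exists (I : Type) (V : I -> set T),
    [/\ p @^-1` U = \bigcup_i V i,
        trivIset setT V,
        forall i, open (V i) &
        forall i, exists s : B -> T,
          [/\ {within U, continuous s},
              forall u, U u -> V i (s u) /\ p (s u) = u &
              forall v, V i v -> s (p v) = v]].

Definition covering_map (T B : topologicalType) (X : set B) (p : T -> B) :
    Prop :=
  [/\ continuous p, range p = X &
      forall x, X x ->
        exists O, [/\ open O, O x & evenly_covered p (X `&` O)]].

Definition universal_cover (T B : topologicalType) (X : set B) (p : T -> B) :
    Prop :=
  covering_map X p /\ simply_connected T.

Definition deck_transformation (T B : topologicalType) (p : T -> B)
    (tau : T -> T) : Prop :=
  [/\ continuous tau,
      exists2 tau' : T -> T, continuous tau' & cancel tau tau' /\ cancel tau' tau &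
      forall x, p (tau x) = p x].

Definition deck_of_loop (T B : topologicalType) (p : T -> B) (g : R -> B)
    (tau : T -> T) : Prop :=
  deck_transformation p tau /\
  exists lift : R -> T,
    [/\ is_path setT lift,
        forall t, unitI t -> p (lift t) = g t &
        lift 1 = tau (lift 0)].

End PathsAndCoverings.

Section Matrices.
Variable R : realType.
Implicit Types (A : 'M[R[i]]_2).

Definition mx2 (x y z t : R[i]) : 'M[R[i]]_2 :=
  \matrix_(i, j) if i == 0 then (if j == 0 then x else y)
                 else (if j == 0 then z else t).

Definition adjmx A : 'M[R[i]]_2 := (map_mx (@conjc R) A)^T.

Definition e3 : 'M[R[i]]_2 := mx2 1 0 0 (-1).

Definition deSitter3 : set 'M[R[i]]_2 :=
  [set X | adjmx X = X /\ \det X = -1].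

Definition SU11 : set 'M[R[i]]_2 :=
  [set A | exists p q : R[i],
     A = mx2 p q q^* p^* /\ `|p| ^+ 2 - `|q| ^+ 2 = 1].

Definition conj_SU11 A B : Prop :=
  exists2 V, SU11 V & A = V *m B *m invmx V.

Definition expi (t : R) : R[i] := cos t +i* sin t.

Definition cosh (s : R) : R := (expR s + expR (- s)) / 2.

Definition sinh (s : R) : R := (expR s - expR (- s)) / 2.

Definition rotation (t : R) : 'M[R[i]]_2 := mx2 (expi t) 0 0 (expi (- t)).

Definition boost (s : R) : 'M[R[i]]_2 :=
  mx2 (cosh s)%:C (sinh s)%:C (sinh s)%:C (cosh s)%:C.

Definition elliptic A : Prop :=
  exists2 t : R, 0 <= t < 2 * pi & conj_SU11 A (rotation t).

Definition hyperbolic A : Prop :=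
  exists2 s : R, s != 0 &
    conj_SU11 A (boost s) \/ conj_SU11 A (- boost s).

End Matrices.

Section Surface.
Variable R : realType.

(* The Riemann sphere: [Some z] is the finite point z and [None] is infinity. *)
Definition sphere : topologicalType := one_point_compactification R[i].

Definition sphere_sqr (w : sphere) : sphere :=
  if w is Some w0 then Some (w0 ^+ 2) else None.

(* z |-> (z+1)(z-a) / ((z-1)(z+a)) on the sphere, with the value 1 at infinity.
   For a > 1 the numerator does not vanish at the zeros of the denominator. *)
Definition ratio (a : R) (z : sphere) : sphere :=
  if z is Some z0 then
    if (z0 - 1) * (z0 + a%:C) == 0 then None
    else Some ((z0 + 1) * (z0 - a%:C) / ((z0 - 1) * (z0 + a%:C)))
  else Some 1.

Definition end_pos : sphere * sphere := (None, Some 1).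
Definition end_neg : sphere * sphere := (None, Some (-1)).

(* [x.1] is z and [x.2] is w. *)
Definition surfaceM (a : R) : set (sphere * sphere) :=
  [set x | sphere_sqr x.2 = ratio a x.1] `\` [set end_pos; end_neg].

(* On [surfaceM a] the coordinate z is always finite. *)
Definition zcoord (x : sphere * sphere) : R[i] := odflt 0 (x.1 : option R[i]).

(* A holomorphic coordinate of [surfaceM a] around x0: the function z where w is
   neither 0 nor infinity, w around a zero of w, and 1/w around a pole of w. *)
Definition chart (x0 x : sphere * sphere) : R[i] :=
  match x0.2 with
  | Some w0 => if w0 == 0 then odflt 0 (x.2 : option R[i]) else zcoord x
  | None => if x.2 is Some w then w^-1 else 0
  end.

Section OnCover.
Variables (T : topologicalType) (p : T -> sphere * sphere).
Variable F : T -> 'M[R[i]]_2.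

(* The complex structure of the cover is pulled back by [p] from the surface. *)
Definition holomorphic_at (x : T) : Prop :=
  exists Fh : R[i] -> 'M[R[i]]_2,
    (\forall y \near x, F y = Fh (chart (p x) (p y))) /\
    (\forall u \near chart (p x) (p x), derivable Fh u (1 : R[i])).

Definition has_dz_derivative (x : T) (D : 'M[R[i]]_2) : Prop :=
  exists Fh : R[i] -> 'M[R[i]]_2,
    (\forall y \near x, F y = Fh (zcoord (p y))) /\
    is_derive (zcoord (p x)) (1 : R[i]) Fh D.

(* F is holomorphic with values in SL(2,C) and dF F^-1 = A dz with
   A = c (1, -w; 1/w, -1).  Both sides are holomorphic 1-forms on the whole
   cover; they are compared where z is a local coordinate, that is, off the
   discrete set where w is 0 or infinity, which determines them. *)
Definition weierstrass_solution (c : R) : Prop :=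
  [/\ forall x, \det (F x) = 1,
      forall x, holomorphic_at x &
      forall x (w : R[i]), (p x).2 = Some w -> w != 0 ->
        has_dz_derivative x
          ((c%:C *: mx2 1 (- w) w^-1 (-1)) *m F x)].

Definition monodromy (g : R -> sphere * sphere) (Phi : 'M[R[i]]_2) : Prop :=
  exists2 tau : T -> T, deck_of_loop p g tau & forall x, F (tau x) = F x *m Phi.

Definition SU11_monodromy (a : R) : Prop :=
  forall g Phi, is_loop (surfaceM a) g -> monodromy g Phi -> SU11 Phi.

(* f = F e3 F^* is a map on [surfaceM a] whose pull-back to the cover is given
   by F; its values outside the surface are irrelevant. *)
Definition face_of (a : R) (f : sphere * sphere -> 'M[R[i]]_2) : Prop :=
  (forall y, surfaceM a y -> deSitter3 (f y)) /\
  (forall x, f (p x) = F x *m e3 R *m adjmx (F x)).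

(* 1/z is a local coordinate vanishing at either end, so a loop near an end
   winds once around it, in one direction or the other, when a continuous
   argument of z varies by 2 pi or - 2 pi along the loop. *)
Definition winds_once (g : R -> sphere * sphere) : Prop :=
  exists rho phi : R -> R,
    [/\ {within `[0, 1], continuous rho}, {within `[0, 1], continuous phi},
        forall t, 0 <= t <= 1 ->
          0 < rho t /\ (g t).1 = Some ((rho t)%:C * expi (phi t)) &
        `|phi 1 - phi 0| = 2 * pi].

(* Every monodromy matrix about the end e has the property P. *)
Definition end_monodromy (a : R) (e : sphere * sphere)
    (P : 'M[R[i]]_2 -> Prop) : Prop :=
  exists2 U : set (sphere * sphere), nbhs e U &
    forall g Phi, is_loop (surfaceM a `&` U) g -> winds_once g ->
      monodromy g Phi -> P Phi.

Definition elliptic_end (a : R) (e : sphere * sphere) : Prop :=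
  end_monodromy a e (@elliptic R).

Definition hyperbolic_end (a : R) (e : sphere * sphere) : Prop :=
  end_monodromy a e (@hyperbolic R).

End OnCover.

(* m is the square root of the real number d, nonnegative or purely imaginary;
   the sign of m is left open in the latter case. *)
Definition square_root_of (d : R) (m : R[i]) : Prop :=
  [/\ m ^+ 2 = d%:C, 0 <= d -> exists2 x : R, 0 <= x & m = x%:C &
      d < 0 -> exists y : R, m = y *i].

End Surface.

(* Main.v *)
(* Away from the branch points the columns (X, Y) of F satisfy the trace-free
   system X' = c (X - w Y), Y' = c (X / w - Y) in z; eliminating Y leaves the
   scalar equation X'' = r (X' - c X) with r = w' / w a rational function of z.
   At z = oo this equation has a regular singular point with exponents
   (1 + m) / 2 and (1 - m) / 2.  As m is not an integer, the Frobenius method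
   gives two solutions z^lam h(1/z), which are functions of s = log z on a half
   plane.  The Wronskian of a column of F with such a solution is constant along
   any loop near the end, and z^lam is multiplied by exp(2 pi i lam) when s
   increases by 2 pi i, so that the monodromy is conjugate in GL(2, C) to a
   diagonal matrix and has trace - 2 cos(pi m).  The trace then determines the
   type of an element of SU(1, 1): it is elliptic when the trace lies in ]-2, 2[
   and hyperbolic when it is less than -2. *)
Require Import Defs.
From mathcomp Require Import all_boot all_order all_algebra.
From mathcomp Require Import complex.
From mathcomp Require Import all_classical all_reals all_analysis.
From mathcomp Require Import ring lra.
Import numFieldNormedType.Exports.
Import Order.TTheory GRing.Theory Num.Theory.
Import Normc.
Set Implicit Arguments.
Unset Strict Implicit.
Unset Printing Implicit Defensive.
Local Open Scope classical_set_scope.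
Local Open Scope ring_scope.
Local Open Scope complex_scope.
Local Notation Re := complex.Re.
Local Notation Im := complex.Im.

(** * Topology of the complex numbers *)

(** Two kinds of multivaluedness shape the argument: [F] lives on the cover, and z^lam is not a
    function of z. No analytic continuation is carried out. A loop supplies a lift to the cover and
    a continuous logarithm of z, and along these two paths only local constancy of the Wronskians is
    needed, the connectedness of [0, 1] doing the rest. [F] itself is never expressed through the
    Frobenius solutions: it is only paired with them, and the pairing matrix conjugates the
    monodromy to a diagonal one. Its invertibility is the independence of the two solutions, whose
    Wronskian has leading coefficient m, the difference of the exponents. The exponents are the
    roots of lam^2 - lam + c (a - 1), of discriminant m^2, and the recurrence for the coefficients
    can be solved as soon as neither m nor - m is a positive integer. The trace does not see the
    sign of a rotation angle, although rotations by t and - t are in general not conjugate in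
    SU(1,1); the sign of Im p decides between them. *)

Section ComplexTopology.
Context {R : realType}.
Implicit Types (z v : R[i]) (x e : R).

Lemma normr_normc z : `|z| = (normc z)%:C.
Proof. by case: z. Qed.

Lemma normc_real x : normc x%:C = `|x|.
Proof. by rewrite /= expr0n addr0 sqrtr_sqr. Qed.

Lemma normc_ge0 z : 0 <= normc z.
Proof. by case: z => x y; exact: sqrtr_ge0. Qed.

Lemma normcB z v : normc (z - v) = normc (v - z).
Proof. by apply: complexI; rewrite -!normr_normc distrC. Qed.

Lemma normc_opp z : normc (- z) = normc z.
Proof. by apply: complexI; rewrite -!normr_normc normrN. Qed.

Lemma normc_triangle z v : normc (z + v) <= normc z + normc v.
Proof. by rewrite -lecR rmorphD /= -!normr_normc ler_normD. Qed.

Lemma normcX z n : normc (z ^+ n) = normc z ^+ n.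
Proof. by apply: complexI; rewrite -normr_normc normrX normr_normc rmorphXn. Qed.

Lemma normc_eq0 z : (normc z == 0) = (z == 0).
Proof. by apply/eqP/eqP => [/eq0_normc|->] //; exact: normc0. Qed.

Lemma normc_gt0 z : (0 < normc z) = (z != 0).
Proof. by rewrite lt_neqAle normc_ge0 andbT eq_sym normc_eq0. Qed.

Lemma normc_sqr1 z : z ^+ 2 = 1 -> normc z = 1.
Proof.
move=> z2; apply/eqP; rewrite -(@eqrXn2 _ 2) ?normc_ge0//.
by rewrite -normcX z2 normc1 expr1n.
Qed.

Lemma Re_le_normc z : `|Re z| <= normc z.
Proof.
case: z => x y /=; rewrite -sqrtr_sqr ler_sqrt ?lerDl ?sqr_ge0//.
by rewrite addr_ge0 ?sqr_ge0.
Qed.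

Lemma Im_le_normc z : `|Im z| <= normc z.
Proof.
case: z => x y /=; rewrite -sqrtr_sqr ler_sqrt ?lerDr ?sqr_ge0//.
by rewrite addr_ge0 ?sqr_ge0.
Qed.

Lemma normc_le_ReIm z : normc z <= `|Re z| + `|Im z|.
Proof.
rewrite [in X in X <= _](complexE z) (le_trans (normc_triangle _ _))//.
rewrite normcM !normc_real lerD2l.
by rewrite (_ : normc 'i = 1) ?mul1r//= expr0n add0r expr1n sqrtr1.
Qed.

Lemma gt0_complex (e : R[i]) : 0 < e -> exists2 d : R, 0 < d & e = d%:C.
Proof.
by case: e => x y; rewrite ltcE/= => /andP[/eqP-> x0]; exists x.
Qed.

(** The norm of [R[i]] takes its values in [R[i]], so that radii are positive complex numbers; real
    radii and [normc] make the estimates accessible to real arithmetic. *)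
Lemma near_complexP z (P : set R[i]) :
  (\forall v \near z, P v) <->
  exists2 d : R, 0 < d & forall v, normc (v - z) < d -> P v.
Proof.
split=> [/nbhs_normP[e /= /gt0_complex[d d0 ->] eP]|[d d0 dP]].
  exists d => // v vd; apply: eP => /=.
  by rewrite normr_normc ltcR normcB.
apply/nbhs_normP; exists d%:C; first by rewrite /= ltcR.
by move=> v /=; rewrite normr_normc ltcR normcB; exact: dP.
Qed.

Lemma cvg_complexP {T} (F : set_system T) {FF : Filter F} (f : T -> R[i]) z :
  f @ F --> z <-> forall e, 0 < e -> \forall t \near F, normc (f t - z) < e.
Proof.
split=> [fz e e0|fz].
  have /cvgrPdistC_lt/(_ e%:C) := fz; rewrite ltcR => /(_ e0).
  by apply: filterS => t; rewrite normr_normc ltcR.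
apply/cvgrPdistC_lt => e /gt0_complex[d d0 ->].
by apply: filterS (fz d d0) => t; rewrite normr_normc ltcR.
Qed.

Lemma cvg_ReIm {T} (F : set_system T) {FF : Filter F} (f : T -> R[i]) x y :
  Re (f t) @[t --> F] --> x -> Im (f t) @[t --> F] --> y -> f @ F --> x +i* y.
Proof.
move=> fx fy; apply/cvg_complexP => e e0.
have e2 : 0 < e / 2 by rewrite divr_gt0.
have /cvgrPdistC_lt/(_ _ e2) fx' := fx.
have /cvgrPdistC_lt/(_ _ e2) fy' := fy.
near=> t; apply: le_lt_trans (normc_le_ReIm _) _; rewrite [e]splitr.
have : `|Re (f t) - x| < e / 2 by near: t.
have : `|Im (f t) - y| < e / 2 by near: t.
by case: (f t) => p q /= *; exact: ltrD.
Unshelve. all: by end_near. Qed.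

End ComplexTopology.

(** * Complex power series *)

Section PowerSeries.
Context {R : realType}.
Implicit Types (b c : nat -> R[i]) (u v z : R[i]) (r : R).

(** Abel's condition: it forces convergence on the open disc of radius [r], and it is easily carried
    through the operations on coefficients used below. *)
Definition coef_bounded b r := exists A : R, forall k, normc (b k) * r ^+ k <= A.

Definition psum b u : R[i] := limn (series (fun k => b k * u ^+ k)).

(** Real and imaginary parts are real series dominated by the geometric series of ratio |u| / r. *)
Lemma cvg_psum b r u : coef_bounded b r -> normc u < r ->
  series (fun k => b k * u ^+ k) @ \oo --> psum b u.
Proof.
move=> [A bA] ur; have r0 : 0 < r by exact: le_lt_trans (normc_ge0 _) ur.
have q1 : `|normc u / r| < 1.
  by rewrite ger0_norm ?divr_ge0 ?normc_ge0 ?ltW// ltr_pdivrMr ?mul1r.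
have key (h : R[i] -> R) : (forall z, `|h z| <= normc z) ->
    cvgn (series (fun k => h (b k * u ^+ k))).
  move=> hn; apply: normed_cvg; rewrite /normed_series_of /=.
  apply: (series_le_cvg (v_ := geometric A (normc u / r))).
  - by move=> n; exact: normr_ge0.
  - move=> n /=; rewrite mulr_ge0 ?exprn_ge0 ?divr_ge0 ?normc_ge0 ?(ltW r0)//.
    by apply: le_trans (bA 0%N); rewrite expr0 mulr1 normc_ge0.
  - move=> n /=; apply: le_trans (hn _) _; rewrite normcM normcX.
    rewrite expr_div_n mulrA ler_pdivlMr ?exprn_gt0// mulrAC.
    by rewrite ler_wpM2r ?exprn_ge0 ?normc_ge0.
  - exact: is_cvg_geometric_series.
rewrite /psum; set s := series _.
have hRe n : Re (s n) = series (fun k => Re (b k * u ^+ k)) n.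
  rewrite /s /series /=; elim: n => [|n IH]; first by rewrite !big_geq.
  by rewrite !big_nat_recr//= -IH; case: (\sum_(0 <= _ < n) _) => ? ?;
    case: (_ * _).
have hIm n : Im (s n) = series (fun k => Im (b k * u ^+ k)) n.
  rewrite /s /series /=; elim: n => [|n IH]; first by rewrite !big_geq.
  by rewrite !big_nat_recr//= -IH; case: (\sum_(0 <= _ < n) _) => ? ?;
    case: (_ * _).
have /cvg_ex[x hx] := key _ Re_le_normc.
have /cvg_ex[y hy] := key _ Im_le_normc.
suff sxy : s @ \oo --> x +i* y by rewrite (cvg_lim _ sxy).
by apply: cvg_ReIm; [under eq_fun do rewrite hRe|under eq_fun do rewrite hIm].
Qed.

Lemma coef_boundedD b c r : 0 <= r -> coef_bounded b r -> coef_bounded c r ->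
  coef_bounded (fun k => b k + c k) r.
Proof.
move=> r0 [A bA] [B cB]; exists (A + B) => k.
apply: le_trans (lerD (bA k) (cB k)).
by rewrite -mulrDl ler_wpM2r ?exprn_ge0// normc_triangle.
Qed.

Lemma coef_boundedZ b z r : coef_bounded b r ->
  coef_bounded (fun k => z * b k) r.
Proof.
move=> [A bA]; exists (normc z * A) => k.
by rewrite normcM -mulrA ler_wpM2l ?normc_ge0.
Qed.

Lemma coef_boundedB b c r : 0 <= r -> coef_bounded b r -> coef_bounded c r ->
  coef_bounded (fun k => b k - c k) r.
Proof.
move=> r0 bb bc; have := coef_boundedD r0 bb (coef_boundedZ (-1) bc).
by congr coef_bounded; apply/funext => k; rewrite mulN1r.
Qed.

Lemma coef_bounded_shift b r : 0 < r -> coef_bounded b r ->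
  coef_bounded (fun k => b k.+1) r.
Proof.
move=> r0 [A bA]; exists (A / r) => k.
by rewrite ler_pdivlMr// -mulrA -exprSr.
Qed.

Lemma coef_bounded_small b r s : 0 <= s <= r ->
  coef_bounded b r -> coef_bounded b s.
Proof.
move=> /andP[s0 sr] [A bA]; exists A => k; apply: le_trans (bA k).
by rewrite ler_wpM2l ?normc_ge0// lerXn2r// nnegrE (le_trans s0).
Qed.

Lemma Bernoulli_ineq (x : R) n : 0 <= x -> 1 + n%:R * x <= (1 + x) ^+ n.
Proof.
move=> x0; elim: n => [|n IH]; first by rewrite mul0r addr0 expr0.
rewrite exprS; apply: (@le_trans _ _ ((1 + x) * (1 + n%:R * x))); last first.
  by rewrite ler_wpM2l// addr_ge0.
have n0 : 0 <= n%:R * x * x by rewrite !mulr_ge0.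
by rewrite -(natr1 n); nra.
Qed.

(** A factor k costs some radius: for r = s (1 + x), Bernoulli's inequality gives k x <= (1 + x)^k =
    (r / s)^k. *)
Lemma coef_bounded_natr b r s : 0 <= s < r ->
  coef_bounded b r -> coef_bounded (fun k => k%:R * b k) s.
Proof.
move=> /andP[s0 sr] [A bA]; move: (s0); rewrite le_eqVlt => /orP[/eqP s00|sp].
  exists 0 => k; rewrite -s00 expr0n; case: k => [|k]; last by rewrite mulr0.
  by rewrite mul0r normc0 mul0r.
pose x := (r - s) / s.
have x0 : 0 < x by rewrite divr_gt0 ?subr_gt0.
have A0 : 0 <= A by apply: le_trans (bA 0%N); rewrite expr0 mulr1 normc_ge0.
have rE : r = s * (1 + x) by rewrite /x; field; rewrite gt_eqF.
exists (A / x) => k; rewrite normcM -(rmorph_nat (real_complex R)) normc_real.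
rewrite ger0_norm// ler_pdivlMr//; apply: le_trans (bA k).
rewrite rE exprMn.
rewrite [X in X <= _](_ : _ = normc (b k) * s ^+ k * (k%:R * x)); last by ring.
rewrite [X in _ <= X]mulrA ler_wpM2l ?mulr_ge0 ?exprn_ge0 ?normc_ge0//.
by apply: le_trans (Bernoulli_ineq _ (ltW x0)); rewrite lerDr.
Qed.

Lemma psumD b c r u : coef_bounded b r -> coef_bounded c r -> normc u < r ->
  psum (fun k => b k + c k) u = psum b u + psum c u.
Proof.
move=> bb bc ur; apply: cvg_lim => //.
rewrite (_ : series _ = series (fun k => b k * u ^+ k) \+
                        series (fun k => c k * u ^+ k)).
  by apply: cvgD; exact: cvg_psum ur.
by apply/funext => n /=; rewrite /series /= -big_split/=;
  under eq_bigr do rewrite mulrDl.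
Qed.

Lemma psumZ b z r u : coef_bounded b r -> normc u < r ->
  psum (fun k => z * b k) u = z * psum b u.
Proof.
move=> bb ur; apply: cvg_lim => //.
rewrite (_ : series _ = (fun n => z * series (fun k => b k * u ^+ k) n)).
  by apply: cvgMl_tmp; exact: cvg_psum ur.
by apply/funext => n /=; rewrite /series /= mulr_sumr;
  under eq_bigr do rewrite -mulrA.
Qed.

Lemma psumB b c r u : coef_bounded b r -> coef_bounded c r -> normc u < r ->
  psum (fun k => b k - c k) u = psum b u - psum c u.
Proof.
move=> bb bc ur; rewrite -mulN1r -(psumZ (-1) bc ur).
rewrite -(psumD bb (coef_boundedZ (-1) bc) ur); congr psum.
by apply/funext => k; rewrite mulN1r.
Qed.

Lemma psum_shift b r u : coef_bounded b r -> normc u < r ->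
  psum b u = b 0%N + u * psum (fun k => b k.+1) u.
Proof.
move=> bb ur; have r0 : 0 < r by exact: le_lt_trans (normc_ge0 _) ur.
apply: cvg_lim => //; rewrite -(cvg_shiftn 1).
rewrite (_ : (fun n => _) =
    (fun n => b 0%N + u * series (fun k => b k.+1 * u ^+ k) n)).
  apply: cvgD; first exact: cvg_cst.
  by apply: cvgMl_tmp; apply: cvg_psum ur; exact: coef_bounded_shift.
apply/funext => n; rewrite /series/= addn1 big_nat_recl// expr0 mulr1.
by rewrite mulr_sumr; congr (_ + _); apply: eq_bigr => i _; rewrite exprS mulrCA.
Qed.

Lemma psum0 b r : 0 < r -> coef_bounded b r -> psum b 0 = b 0%N.
Proof.
by move=> r0 bb; rewrite (@psum_shift _ r) ?mul0r ?addr0// normc0.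
Qed.

Lemma normc_psum b r u A : (forall k, normc (b k) * r ^+ k <= A) ->
  normc u < r -> normc (psum b u) <= A / (1 - normc u / r).
Proof.
move=> bA ur; have r0 : 0 < r by exact: le_lt_trans (normc_ge0 _) ur.
have A0 : 0 <= A by apply: le_trans (bA 0%N); rewrite expr0 mulr1 normc_ge0.
have q0 : 0 <= normc u / r by rewrite divr_ge0 ?normc_ge0 ?(ltW r0).
have q1 : normc u / r < 1 by rewrite ltr_pdivrMr ?mul1r.
have /cvg_complexP bu : series (fun k => b k * u ^+ k) @ \oo --> psum b u.
  by apply: cvg_psum ur; exists A.
apply/ler_addgt0Pr => e e0.
have [N _ /(_ N (leqnn _)) /=] := bu e e0.
set s := series _ N => se.
have sA : normc s <= A / (1 - normc u / r).
  apply: (@le_trans _ _ (\sum_(0 <= k < N) A * (normc u / r) ^+ k)).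
    rewrite /s /series/=; elim: (N) => [|n IH]; first by rewrite !big_geq// normc0.
    rewrite !big_nat_recr//=; apply: le_trans (normc_triangle _ _) _.
    rewrite lerD// normcM normcX expr_div_n mulrA ler_pdivlMr ?exprn_gt0// mulrAC.
    by rewrite ler_wpM2r ?exprn_ge0 ?normc_ge0.
  rewrite -mulr_sumr ler_wpM2l// -[X in _ <= X]div1r ler_pdivlMr ?subr_gt0//.
  rewrite (_ : _ * (1 - normc u / r) = 1 - (normc u / r) ^+ N) ?gerBl ?exprn_ge0//.
  by rewrite big_mkord -[1 - normc u / r]opprB mulrN mulrC -subrX1 opprB.
apply: le_trans (lerD sA (ltW se)).
have := normc_triangle s (psum b u - s).
by rewrite [s + _]addrC subrK [normc (psum b u - s)]normcB.
Qed.

End PowerSeries.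

Opaque psum.

(** * Complex differentiation *)

(** The form without quotients, over any [numFieldType]: it serves both complex derivatives and the
    real ones of exp, cos, sin and of functions along a segment. *)
Lemma is_derive_normP (K : numFieldType) (f : K -> K) (z d : K) :
  is_derive z 1 f d <->
  forall e : K, 0 < e -> exists2 r : K, 0 < r &
    forall v, `|v - z| < r -> `|f v - f z - (v - z) * d| <= e * `|v - z|.
Proof.
split=> [[fz fd] e e0|H].
  have /cvgrPdistC_lt/(_ e e0) : h^-1 *: (f (h *: 1 + z) - f z) @[h --> 0^'] --> d.
    by rewrite -fd; exact: fz.
  rewrite near_withinE => /nbhs_normP[r r0 hr]; exists r => // v vr.
  have [->|vz] := eqVneq v z; first by rewrite !subrr mul0r subrr normr0 mulr0.
  have vz0 : v - z != 0 by rewrite subr_eq0.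
  have := hr (v - z); rewrite /= sub0r normrN vr => /(_ erefl vz0).
  rewrite /GRing.scale/= mulr1 subrK => /ltW.
  move=> /(ler_wpM2r (normr_ge0 (v - z))).
  rewrite -normrM mulrBl mulrAC mulVf// mul1r [d * _]mulrC.
  exact.
have fd : h^-1 *: (f (h *: 1 + z) - f z) @[h --> 0^'] --> d.
  apply/cvgrPdistC_lt => e e0.
  have [r r0 hr] := H (e / 2) (divr_gt0 e0 (ltr0n _ 2)).
  rewrite near_withinE; apply/nbhs_normP; exists r => // h.
  rewrite /= sub0r normrN => hr' h0; have := hr (h + z); rewrite addrK => /(_ hr').
  rewrite /GRing.scale/= mulr1 => he.
  have n0 : 0 < `|h| by rewrite normr_gt0.
  rewrite -(ltr_pM2r n0) -normrM mulrBl mulrAC mulVf// mul1r [d * _]mulrC.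
  by apply: le_lt_trans he _; rewrite ltr_pM2r// ltr_pdivrMr// ltr_pMr// ltr1n.
by apply: DeriveDef; [apply/cvg_ex; exists d|exact: cvg_lim fd].
Qed.

Section ComplexDerivative.
Context {R : realType}.
Implicit Types (f g : R[i] -> R[i]) (z d : R[i]).

Lemma is_derive_complexP f z d :
  is_derive z 1 f d <->
  forall e : R, 0 < e -> exists2 r : R, 0 < r &
    forall v, normc (v - z) < r ->
      normc (f v - f z - (v - z) * d) <= e * normc (v - z).
Proof.
split=> [/is_derive_normP fd e e0|fd].
  have := fd e%:C; rewrite ltcR => /(_ e0)[_ /gt0_complex[r r0 ->] fr].
  exists r => // v vr; have := fr v; rewrite !normr_normc ltcR -rmorphM/= lecR.
  exact.
apply/is_derive_normP => _ /gt0_complex[e e0 ->]; have [r r0 fr] := fd e e0.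
exists r%:C => [|v]; first by rewrite ltcR.
by rewrite !normr_normc ltcR -rmorphM/= lecR; exact: fr.
Qed.

Lemma is_derive_continuous f z d : is_derive z 1 f d -> {for z, continuous f}.
Proof.
by move=> [/derivable1_diffP fz _]; exact: differentiable_continuous.
Qed.

Lemma is_derive_compc f g z df dg d : is_derive z 1 f df ->
  is_derive (f z) 1 g dg -> dg * df = d -> is_derive z 1 (fun v => g (f v)) d.
Proof.
move=> hf hg <-; have /cvg_complexP fc := is_derive_continuous hf.
move: hf hg => /is_derive_complexP hf /is_derive_complexP hg.
apply/is_derive_complexP => e e0.
set nf := normc df; set ng := normc dg.
have nf0 : 0 <= nf := normc_ge0 _.
have ng0 : 0 <= ng := normc_ge0 _.
(* The increment of [f] is at most (1 + nf) |v - z|, thanks to the bound 1 in the minimum below; the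
   two tolerances then leave e / 2 for each of the two errors. *)
have e1 : 0 < e / 2 / (1 + nf) by rewrite !divr_gt0// ltr_pwDl.
have e2 : 0 < Num.min 1 (e / 2 / (1 + ng)).
  by rewrite lt_min ltr01 !divr_gt0// ltr_pwDl.
have [r1 r10 gr] := hg _ e1.
have [r2 r20 fr] := hf _ e2.
have /near_complexP[r3 r30 fr3] := fc _ r10.
exists (Num.min r2 r3); first by rewrite lt_min r20.
move=> v; rewrite lt_min => /andP[/fr v2 /fr3/gr v3].
set D := v - z in v2 *; set A := f v - f z in v2 v3.
have -> : g (f v) - g (f z) - D * (dg * df) =
  (g (f v) - g (f z) - A * dg) + (A - D * df) * dg.
  by move: (g (f v)) (g (f z)) A D {v2 v3} => p q A D; ring.
clearbody D A.
have nD0 := normc_ge0 D.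
have nA : normc A <= (1 + nf) * normc D.
  rewrite -[A](subrK (D * df)) mulrDl mul1r.
  apply: le_trans (normc_triangle _ _) _; rewrite normcM [normc D * _]mulrC lerD2r.
  by apply: le_trans v2 _; rewrite ler_piMl// ge_min lexx.
apply: le_trans (normc_triangle _ _) _; rewrite [e]splitr [X in _ <= X]mulrDl.
apply: lerD.
  apply: le_trans v3 _; rewrite -mulrA ler_wpM2l ?divr_ge0 ?(ltW e0)//.
  by rewrite ler_pdivrMl ?ltr_pwDl.
rewrite normcM; apply: (@le_trans _ _ (e / 2 / (1 + ng) * normc D * ng)).
  apply: ler_wpM2r => //; apply: le_trans v2 _; apply: ler_wpM2r => //.
  by rewrite ge_min lexx orbT.
rewrite [X in X <= _](_ : _ = e / 2 * normc D * (ng / (1 + ng))); last by ring.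
rewrite ler_piMr ?mulr_ge0 ?invr_ge0 ?(ltW e0)//.
by rewrite ler_pdivrMr ?ltr_pwDl// mul1r lerDr.
Qed.

(* The witness is the sequence of tails [c k = sum_i b (k + 1 + i) u^i]. *)
Lemma psum_quotient b (r : R) u : coef_bounded b r -> normc u < r ->
  exists c, [/\ coef_bounded c r,
    forall v, normc v < r -> psum b v - psum b u = (v - u) * psum c v &
    forall k, c k = b k.+1 + u * c k.+1].
Proof.
move=> bb ur; have r0 : 0 < r by exact: le_lt_trans (normc_ge0 _) ur.
have bS k : coef_bounded (fun i => b (k + i)%N) r.
  elim: k => [|k IH]; first exact: bb.
  have := coef_bounded_shift r0 IH; congr coef_bounded.
  by apply/funext => i; rewrite addnS.
pose c k := psum (fun i => b (k.+1 + i)%N) u.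
have cE k : c k = b k.+1 + u * c k.+1.
  have -> : c k.+1 = psum (fun i => b (k.+1 + i.+1)%N) u.
    by congr (psum _ u); apply/funext => i; rewrite addnS.
  by have := psum_shift (bS k.+1) ur; rewrite addn0.
have cb : coef_bounded c r.
  have [A bA] := bb; pose D := 1 - normc u / r.
  have D0 : 0 < D by rewrite subr_gt0 ltr_pdivrMr ?mul1r.
  exists (A / r / D) => k.
  have rk : 0 < r ^+ k.+1 by rewrite exprn_gt0.
  have := @normc_psum _ (fun i => b (k.+1 + i)%N) r u (A / r ^+ k.+1) _ ur.
  move=> /(_ _)/le_trans H; rewrite -ler_pdivlMr ?exprn_gt0//; apply: H.
    by move=> i; rewrite ler_pdivlMr// -mulrA -exprD addnC.
  rewrite -/D exprS (_ : A / (r * r ^+ k) / D = A / r / D / r ^+ k)//.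
  by rewrite invfM; ring.
exists c; split=> // v vr.
have cbS := coef_bounded_shift r0 cb.
have bE : (fun k => b k.+1) = (fun k => c k - u * c k.+1).
  by apply/funext => k; rewrite cE addrK.
have b0E : psum b u = b 0%N + u * c 0%N.
  by rewrite (psum_shift bb ur) /c; congr (_ + _ * psum _ _); apply/funext => i;
    rewrite add1n.
have cv := psum_shift cb vr.
rewrite (psum_shift bb vr) bE (psumB cb (coef_boundedZ u cbS) vr) (psumZ u cbS vr).
rewrite b0E; move: (psum c v) (psum _ v) cv => Y X ->.
by move: (b 0%N) (c 0%N) => p q; ring.
Qed.

(** Substituting b (k+1) = c k - u c (k+1) turns (k+1) b (k+1) into c k plus k c k - u (k+1) c
    (k+1), and the latter terms sum to 0 against u^k. *)
Lemma psum_derive_coef b c (r : R) u : coef_bounded c r -> normc u < r ->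
  (forall k, c k = b k.+1 + u * c k.+1) ->
  psum (fun k => k.+1%:R * b k.+1) u = psum c u.
Proof.
move=> cb ur cE; have r0 : 0 < r by exact: le_lt_trans (normc_ge0 _) ur.
pose s := (normc u + r) / 2.
have us : normc u < s by rewrite /s; lra.
have sr : s < r by rewrite /s; lra.
have s0 : 0 < s by exact: le_lt_trans (normc_ge0 _) us.
have cs : coef_bounded c s by apply: coef_bounded_small cb; rewrite !ltW.
have kcs : coef_bounded (fun k => k%:R * c k) s.
  by apply: coef_bounded_natr cb; rewrite (ltW s0).
have kcS := coef_bounded_shift s0 kcs.
have -> : (fun k => k.+1%:R * b k.+1) =
          (fun k => (k%:R * c k + c k) - u * (k.+1%:R * c k.+1)).
  by apply/funext => k; rewrite [c k]cE -(natr1 k); ring.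
rewrite (psumB (coef_boundedD (ltW s0) kcs cs) (coef_boundedZ u kcS) us).
rewrite (psumD kcs cs us) (psumZ u kcS us) (psum_shift kcs us) mul0r add0r.
by rewrite addrAC subrr add0r.
Qed.

(** Dividing by v - u twice shows that the error of the linear approximation is (v - u)^2 times a
    power series, which is bounded on a smaller disc. *)
Lemma is_derive_psum b (r : R) u : coef_bounded b r -> normc u < r ->
  is_derive u 1 (psum b) (psum (fun k => k.+1%:R * b k.+1) u).
Proof.
move=> bb ur; have r0 : 0 < r by exact: le_lt_trans (normc_ge0 _) ur.
have [c [cb bc cE]] := psum_quotient bb ur.
have [c' [[A c'A] cc' _]] := psum_quotient cb ur.
rewrite (psum_derive_coef cb ur cE).
pose s := (normc u + r) / 2.
have us : normc u < s by rewrite /s; lra.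
have sr : s < r by rewrite /s; lra.
have A0 : 0 <= A by apply: le_trans (c'A 0%N); rewrite expr0 mulr1 normc_ge0.
have sr1 : 0 < 1 - s / r by rewrite subr_gt0 ltr_pdivrMr ?mul1r.
pose B := A / (1 - s / r).
have B0 : 0 <= B by rewrite divr_ge0// ltW.
apply/is_derive_complexP => e e0.
(* The first bound keeps [v] in the disc of radius [s], where the second quotient is at most [B];
   the second one absorbs [B], with + 1 because [B] may be 0. *)
exists (Num.min (s - normc u) (e / (B + 1))).
  by rewrite lt_min subr_gt0 us divr_gt0// ltr_wpDl.
move=> v; rewrite lt_min => /andP[vs ve].
have vs' : normc v < s.
  rewrite -(subrK u v); apply: le_lt_trans (normc_triangle _ _) _.
  by rewrite -ltrBrDr.
have vr := lt_trans vs' sr.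
rewrite (bc v vr) -mulrBr (cc' v vr) !normcM mulrC ler_wpM2r ?normc_ge0//.
have vB : normc (psum c' v) <= B.
  apply: le_trans (normc_psum c'A vr) _; rewrite ler_wpM2l// lef_pV2 ?posrE//.
    by rewrite lerB// ler_pM2r ?invr_gt0// ltW.
  by apply: lt_le_trans sr1 _; rewrite lerB// ler_pM2r ?invr_gt0// ltW.
apply: (@le_trans _ _ (e / (B + 1) * B)).
  by apply: ler_pM; rewrite ?normc_ge0// ltW.
by rewrite mulrAC ler_pdivrMr ?ltr_wpDl// ler_pM2l// lerDl.
Qed.

End ComplexDerivative.

(** * The complex exponential *)

Section ComplexExponential.
Context {R : realType}.
Implicit Types (s z : R[i]) (x : R).

(** The polar form makes ln rho + i phi a logarithm of rho exp (i phi), which is how [winds_once]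
    describes z. *)
Definition cexp s : R[i] := (expR (Re s))%:C * expi (Im s).

Lemma expiD x y : expi (x + y) = expi x * expi y.
Proof. by rewrite /expi cosD sinD; simpc; congr (_ +i* _); rewrite addrC. Qed.

Lemma cexpD s z : cexp (s + z) = cexp s * cexp z.
Proof.
case: s z => x y [p q]; rewrite /cexp /= expRD expiD rmorphM /=.
by rewrite mulrACA.
Qed.

Lemma cexp0 : cexp 0 = 1.
Proof. by rewrite /cexp/= expR0 /expi cos0 sin0 mul1r. Qed.

Lemma normc_expi x : normc (expi x) = 1.
Proof. by rewrite /= cos2Dsin2 sqrtr1. Qed.

Lemma normc_cexp s : normc (cexp s) = expR (Re s).
Proof. by rewrite normcM normc_expi mulr1 normc_real ger0_norm ?expR_ge0. Qed.

Lemma cexp_neq0 s : cexp s != 0.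
Proof. by rewrite -normc_eq0 normc_cexp gt_eqF ?expR_gt0. Qed.

Lemma cexpN s : cexp (- s) = (cexp s)^-1.
Proof.
by apply: (mulfI (cexp_neq0 s)); rewrite -cexpD subrr cexp0 divff ?cexp_neq0.
Qed.

Lemma cexp_real x : cexp x%:C = (expR x)%:C.
Proof. by rewrite /cexp/= /expi cos0 sin0 mulr1. Qed.

Lemma cexp_imag x : cexp (x *i) = expi x.
Proof. by rewrite /cexp/= expR0 mul1r. Qed.

(** Complex differentiability at 0, obtained from the real derivatives of exp, cos and sin there;
    the functional equation carries it to every other point. *)
Lemma cexp_asymp (e : R) : 0 < e -> exists2 r : R, 0 < r &
  forall h, normc h < r -> normc (cexp h - 1 - h) <= e * normc h.
Proof.
(* With m this minimum and n = |h|, the real and imaginary parts of the error are at most 4 m n and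
   5 m n, so that e / 16 is enough; the bound 1 gives exp x <= 3. *)
move=> e0; have e4 : 0 < Num.min (e / 16) 1 by rewrite lt_min ltr01 divr_gt0.
have small (f : R -> R) (d : R) : is_derive (0 : R) (1 : R) f d ->
  exists2 r : R, 0 < r &
    forall x, `|x| < r -> `|f x - f 0 - x * d| <= Num.min (e / 16) 1 * `|x|.
  move=> /is_derive_normP/(_ _ e4)[r r0 fr]; exists r => // x xr.
  by have := fr x; rewrite subr0; exact.
have [r1 r10 h1] := small expR _ (is_derive_expR 0).
have [r2 r20 h2] := small (@cos R) _ (is_derive_cos 0).
have [r3 r30 h3] := small (@sin R) _ (is_derive_sin 0).
exists (Num.min (Num.min r1 r2) (Num.min r3 (Num.min (e / 16) 1))).
  by rewrite !lt_min r10 r20 r30 -lt_min e4.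
case=> x y; rewrite 3!lt_min => /andP[/andP[+ +] /andP[+ +]].
set n := normc _ => n1 n2 n3 n4.
have n0 : 0 <= n := normc_ge0 _.
have lx : `|x| <= n := Re_le_normc (x +i* y).
have ly : `|y| <= n := Im_le_normc (x +i* y).
apply: le_trans (normc_le_ReIm _) _; rewrite /cexp/=.
have := h1 x (le_lt_trans lx n1); have := h2 y (le_lt_trans ly n2).
have := h3 y (le_lt_trans ly n3).
rewrite sin0 cos0 expR0 oppr0 mulr0 !mulr1 !subr0 !addr0 => hs hc he.
rewrite !(mul0r, subr0, addr0, oppr0).
set m := Num.min _ _ in e4 n4 hs hc he.
have m1 : m <= 1 by rewrite ge_min lexx orbT.
have me : m <= e / 16 by rewrite ge_min lexx.
set E := expR x in he *; set C := cos y in hc *; set S := sin y in hs *.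
have E3 : `|E| <= 3.
  have -> : E = (E - 1 - x) + x + 1 by ring.
  apply: le_trans (ler_normD _ _) _; rewrite normr1.
  have := ler_normD (E - 1 - x) x.
  have : m * `|x| <= 1 by apply: mulr_ile1 => //; lra.
  lra.
have E1 : `|E - 1| <= 2 * n.
  have -> : E - 1 = (E - 1 - x) + x by ring.
  apply: le_trans (ler_normD _ _) _.
  have : m * `|x| <= 1 * `|x| by rewrite ler_wpM2r.
  lra.
have mn : m * n <= e / 16 * n by rewrite ler_wpM2r.
have mx : m * `|x| <= m * n by rewrite ler_wpM2l// ltW.
have my : m * `|y| <= m * n by rewrite ler_wpM2l// ltW.
have re : `|E * C - 1 - x| <= 4 * (m * n).
  have -> : E * C - 1 - x = (E - 1 - x) + E * (C - 1) by ring.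
  apply: le_trans (ler_normD _ _) _; rewrite normrM.
  have : `|E| * `|C - 1| <= 3 * (m * n) by apply: ler_pM => //; lra.
  lra.
have im : `|E * S - y| <= 5 * (m * n).
  have -> : E * S - y = E * (S - y) + (E - 1) * y by ring.
  apply: le_trans (ler_normD _ _) _; rewrite !normrM.
  have : `|E| * `|S - y| <= 3 * (m * n) by apply: ler_pM => //; lra.
  have : `|E - 1| * `|y| <= 2 * n * m by apply: ler_pM => //; lra.
  lra.
have en : 0 <= e * n by rewrite mulr_ge0// ltW.
lra.
Qed.

Lemma is_derive_cexp s : is_derive s 1 cexp (cexp s).
Proof.
apply/is_derive_complexP => e e0.
have n0 : 0 < normc (cexp s) by rewrite normc_gt0 cexp_neq0.
have [r r0 hr] := cexp_asymp (divr_gt0 e0 n0).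
exists r => // v /hr vr.
have {1}-> : v = s + (v - s) by rewrite addrC subrK.
rewrite cexpD (_ : _ - _ - _ = cexp s * (cexp (v - s) - 1 - (v - s))).
  by rewrite normcM mulrC -ler_pdivlMr// [X in _ <= X]mulrAC.
by move: (cexp s) (cexp (v - s)) (v - s) => p q t; ring.
Qed.

End ComplexExponential.

(** * The Frobenius method at infinity *)

Section Frobenius.
Context {R : realType}.
Implicit Types (b f : nat -> R[i]) (u s lam mu : R[i]) (r : R).

(** The n-th iterate of the functional is already final at all indices below n, so its diagonal is a
    fixed point. *)
Lemma strong_recursion (T : Type) (t0 : T) (G : nat -> (nat -> T) -> T) :
  (forall k (f g : nat -> T), (forall j, (j < k)%N -> f j = g j) ->
    G k f = G k g) ->
  exists b : nat -> T, forall k, b k = G k b.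
Proof.
move=> Gext; pose h n := iter n (fun (f : nat -> T) k => G k f) (fun=> t0).
have hS n k : h n.+1 k = G k (h n) by [].
have hE k n : (k < n)%N -> h n k = h k.+1 k.
  elim/ltn_ind: k n => k IH [//|n]; rewrite ltnS => kn.
  rewrite !hS; apply: Gext => j jk.
  by rewrite (IH _ jk _ (leq_trans jk kn)) (IH _ jk _ jk).
exists (fun k => h k.+1 k) => k; rewrite hS; apply: Gext => j jk.
exact: hE.
Qed.

(** The coefficients of u times the series; the value 0 at index 0 stands for the coefficient of
    index - 1. *)
Definition delay b k : R[i] := if k is k'.+1 then b k' else 0.

Lemma coef_bounded_delay b r : 0 <= r -> coef_bounded b r ->
  coef_bounded (delay b) r.
Proof.
move=> r0 [A bA]; have A0 : 0 <= A.
  by apply: le_trans (bA 0%N); rewrite expr0 mulr1 normc_ge0.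
exists (r * A) => -[|k]; rewrite /delay; first by rewrite normc0 mul0r mulr_ge0.
by rewrite exprS mulrCA ler_wpM2l.
Qed.

Lemma psum_delay b r u : coef_bounded b r -> normc u < r ->
  psum (delay b) u = u * psum b u.
Proof.
move=> bb ur; have r0 : 0 < r by exact: le_lt_trans (normc_ge0 _) ur.
by rewrite (psum_shift (coef_bounded_delay (ltW r0) bb) ur) add0r.
Qed.

Lemma delay_ext b f k : (forall j, (j < k)%N -> b j = f j) ->
  delay b k = delay f k.
Proof. by case: k => //= k; apply. Qed.

Lemma normc_delay b k (X : R) : 0 <= X -> (forall j, (j < k)%N ->
  normc (b j) <= X) ->
  normc (delay b k) <= X.
Proof. by case: k => [|k] X0 H; rewrite /delay ?normc0// H. Qed.

Lemma natr_sub_lower_bound mu : (forall k, (0 < k)%N -> k%:R != mu) ->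
  exists2 d : R, 0 < d & forall k, (0 < k)%N -> d * k%:R <= normc (k%:R - mu).
Proof.
move=> muN; have n0 := normc_ge0 mu.
have [N Nmu] : exists N : nat, 2 * normc mu < N%:R.
  by exists (Num.truncn (2 * normc mu)).+1; rewrite -truncn_lt_nat// mulr_ge0.
have normcn k : normc (k%:R : R[i]) = k%:R.
  by rewrite -(rmorph_nat (real_complex R)) normc_real ger0_norm.
have [d d0 dN] : exists2 d : R, 0 < d & forall k, (0 < k < N)%N ->
  d * k%:R <= normc (k%:R - mu).
  elim: (N) => [|n [d d0 IH]]; first by exists 1 => // k; rewrite ltn0 andbF.
  case: (posnP n) => [->|n1]; first by exists 1 => // -[|[]].
  have m0 : 0 < normc (n%:R - mu) / n%:R.
    by rewrite divr_gt0 ?ltr0n// normc_gt0 subr_eq0 muN.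
  exists (Num.min d (normc (n%:R - mu) / n%:R)); first by rewrite lt_min d0.
  move=> k /andP[k0]; rewrite ltnS leq_eqVlt => /orP[/eqP->|kn].
    by rewrite -ler_pdivlMr ?ltr0n// ge_min lexx orbT.
  apply: le_trans (IH k _); last by rewrite k0.
  by rewrite ler_wpM2r// ge_min lexx.
exists (Num.min d (1 / 2)); first by rewrite lt_min d0 divr_gt0.
move=> k k0; case: (ltnP k N) => [kN|Nk].
  by apply: le_trans (dN k _); rewrite ?k0// ler_wpM2r// ge_min lexx.
apply: (@le_trans _ _ (1 / 2 * k%:R)).
  by rewrite ler_wpM2r// ge_min lexx orbT.
have := normc_triangle (k%:R - mu) mu; rewrite subrK normcn.
have : N%:R <= k%:R :> R by rewrite ler_nat.
lra.
Qed.

Context (a c lam : R[i]).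

(* For f = u^(-lam) * psum b u with u = e^(-s) and ' = d/ds, the equation
     (1 - u^2) (1 - a^2 u^2) (f'' - f') = (a - 1) (1 + a u^2) (u f' - c f)
   amounts, for all k, to
     (lam - k) (lam - k - 1) b k + c (a - 1) b k = frob_rhs b k. *)
Definition frob_rhs b k : R[i] :=
  (1 + a ^+ 2) *
    delay (delay (fun j => (lam - j%:R) * (lam - j%:R - 1) * b j)) k
  - a ^+ 2 * delay (delay (delay (delay
      (fun j => (lam - j%:R) * (lam - j%:R - 1) * b j)))) k
  + (a - 1) * delay (fun j => (lam - j%:R) * b j) k
  + (a - 1) * a * delay (delay (delay (fun j => (lam - j%:R) * b j))) k
  - (a - 1) * a * c * delay (delay b) k.

(** Each term of [frob_rhs] carries at least one delay, which makes the recurrence well founded. *)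
Lemma frob_rhs_ext b f k : (forall j, (j < k)%N -> b j = f j) ->
  frob_rhs b k = frob_rhs f k.
Proof.
move=> bf.
have D (b' f' : nat -> R[i]) : (forall j, (j < k)%N -> b' j = f' j) ->
    forall j, (j < k)%N -> delay b' j = delay f' j.
  by move=> H j jk; apply: delay_ext => i ij; apply: H; exact: ltn_trans jk.
have E1 j : (j < k)%N -> (lam - j%:R) * b j = (lam - j%:R) * f j by move=> /bf ->.
have E2 j : (j < k)%N -> (lam - j%:R) * (lam - j%:R - 1) * b j =
    (lam - j%:R) * (lam - j%:R - 1) * f j by move=> /bf ->.
by rewrite /frob_rhs (delay_ext (D _ _ E2)) (delay_ext (D _ _ (D _ _ (D _ _ E2))))
  (delay_ext E1) (delay_ext (D _ _ (D _ _ E1))) (delay_ext (D _ _ bf)).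
Qed.

(** As lam is a root of the indicial polynomial, the factor of b k is k (k - (2 lam - 1)), which is
    nonzero for k > 0. It grows like k^2, as fast as the coefficients of [frob_rhs], so that the b k
    grow at most geometrically. *)
Lemma frobenius_coef : lam ^+ 2 - lam + c * (a - 1) = 0 ->
  (forall k, (0 < k)%N -> k%:R != 2 * lam - 1) ->
  exists b, [/\ b 0%N = 1, exists2 r : R, 0 < r & coef_bounded b r &
    forall k, (lam - k%:R) * (lam - k%:R - 1) * b k + c * (a - 1) * b k =
      frob_rhs b k].
Proof.
move=> lam0 lamN.
have [b bE] := @strong_recursion R[i] 0 (fun k b => if k == 0%N then 1 else
  frob_rhs b k / (k%:R * (k%:R - (2 * lam - 1)))) (fun k f g fg =>
  congr1 (fun x => if k == 0%N then 1 else x / (k%:R * (k%:R - (2 * lam - 1))))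
    (frob_rhs_ext fg)).
have b0 : b 0%N = 1 by rewrite bE.
have k0C k : (0 < k)%N -> (k%:R : R[i]) != 0 by rewrite pnatr_eq0 -lt0n.
have rec k : (lam - k%:R) * (lam - k%:R - 1) * b k + c * (a - 1) * b k =
  frob_rhs b k.
  have -> : (lam - k%:R) * (lam - k%:R - 1) * b k + c * (a - 1) * b k =
      (lam ^+ 2 - lam + c * (a - 1)) * b k + k%:R * (k%:R - (2 * lam - 1)) * b k
        by ring.
  rewrite lam0 mul0r add0r; case: k => [|k].
    by rewrite !mul0r /frob_rhs /= !mulr0 !subr0 !addr0.
  rewrite [b k.+1]bE /= mulrC divfK// mulf_neq0 ?k0C// subr_eq0; exact: lamN.
exists b; split=> //.
have [d d0 dP] := natr_sub_lower_bound lamN.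
(* [L] bounds the factors lam - j and lam - j - 1 by L (k+1) for j <= k, [K] adds up the moduli of
   the five coefficients of [frob_rhs], and [B] is the resulting growth rate, kept at least 1. *)
pose L := normc lam + 2.
have L1 : 1 <= L by rewrite /L; have := normc_ge0 lam; lra.
pose K := normc (1 + a ^+ 2) + normc (a ^+ 2) + normc (a - 1) + normc ((a - 1) *
  a) + normc ((a - 1) * a * c).
have K0 : 0 <= K by rewrite /K !addr_ge0 ?normc_ge0.
pose B := 1 + K * L ^+ 2 / d.
have L0 : 0 <= L by lra.
have B1 : 1 <= B by rewrite lerDl divr_ge0 ?mulr_ge0 ?exprn_ge0// ltW.
have normcn k : normc (k%:R : R[i]) = k%:R.
  by rewrite -(rmorph_nat (real_complex R)) normc_real ger0_norm.
have bB k : normc (b k) <= B ^+ k.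
  elim/ltn_ind: k => -[_|k IH]; first by rewrite b0 normc1 expr0.
  have kR : 1 <= k.+1%:R :> R by rewrite ler1n.
  pose X := L ^+ 2 * k.+1%:R ^+ 2 * B ^+ k.
  have X0 : 0 <= X by rewrite !mulr_ge0 ?exprn_ge0// (le_trans _ B1).
  have bj j : (j < k.+1)%N -> normc (b j) <= B ^+ k.
    by move=> jk; apply: le_trans (IH j jk) _; rewrite ler_weXn2l.
  have lj j : (j < k.+1)%N -> normc (lam - j%:R) <= L * k.+1%:R.
    move=> jk; apply: le_trans (normc_triangle _ _) _; rewrite normc_opp normcn.
    have : j%:R <= k.+1%:R :> R by rewrite ler_nat ltnW.
    rewrite /L; have := normc_ge0 lam; nra.
  have lj1 j : (j < k.+1)%N -> normc (lam - j%:R - 1) <= L * k.+1%:R.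
    move=> jk; rewrite -addrA -opprD natr1.
    apply: le_trans (normc_triangle _ _) _; rewrite normc_opp normcn.
    have : j.+1%:R <= k.+1%:R :> R by rewrite ler_nat.
    rewrite /L; have := normc_ge0 lam; nra.
  have Lk : 1 <= L * k.+1%:R by exact: mulr_ege1.
  have B0 : 0 <= B ^+ k by rewrite exprn_ge0// (le_trans _ B1).
  have h0 j : (j < k.+1)%N -> normc (b j) <= X.
    move=> /bj bjk; apply: le_trans bjk _; rewrite /X -exprMn ler_peMl// expr_ge1//.
    exact: le_trans Lk.
  have h1 j : (j < k.+1)%N -> normc ((lam - j%:R) * b j) <= X.
    move=> jk; rewrite normcM /X -exprMn expr2 -(mulrA (L * _)).
    rewrite ler_pM ?normc_ge0 ?lj//.
    by apply: le_trans (bj j jk) _; rewrite ler_peMl.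
  have h2 j : (j < k.+1)%N -> normc ((lam - j%:R) * (lam - j%:R - 1) * b j) <= X.
    move=> jk; rewrite !normcM /X -exprMn expr2.
    rewrite ler_pM ?mulr_ge0 ?normc_ge0 ?bj//.
    by rewrite ler_pM ?normc_ge0 ?lj ?lj1.
  have dX (w : nat -> R[i]) : (forall j, (j < k.+1)%N -> normc (w j) <= X) ->
      forall j, (j < k.+1)%N -> normc (delay w j) <= X.
    move=> H j jk; apply: normc_delay => // i ij; apply: H.
    exact: ltn_trans jk.
  have rX : normc (frob_rhs b k.+1) <= K * X.
    have dY (w : nat -> R[i]) z : (forall j, (j < k.+1)%N -> normc (w j) <= X) ->
        normc (z * delay w k.+1) <= normc z * X.
      by move=> H; rewrite normcM ler_wpM2l ?normc_ge0// normc_delay.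
    have := dY _ ((a - 1) * a * c) (dX _ h0).
    have := dY _ ((a - 1) * a) (dX _ (dX _ h1)).
    have := dY _ (a - 1) h1.
    have := dY _ (a ^+ 2) (dX _ (dX _ (dX _ h2))).
    have := dY _ (1 + a ^+ 2) (dX _ h2).
    rewrite /frob_rhs /K !(mulrDl _ _ X).
    move: ((1 + a ^+ 2) * _) (a ^+ 2 * _) ((a - 1) * delay _ _) ((a - 1) * a * _)
      ((a - 1) * a * c * _) => t1 t2 t3 t4 t5 *.
    do 4![apply: le_trans (normc_triangle _ _) _; rewrite ?normc_opp lerD//].
  have k0 : 0 < k.+1%:R :> R by rewrite ltr0n.
  rewrite bE /= normcM normcV normcM normcn ler_pdivrMr; last first.
    by rewrite mulr_gt0// normc_gt0 subr_eq0 lamN.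
  apply: le_trans rX _.
  apply: (@le_trans _ _ (B ^+ k.+1 * (k.+1%:R * (d * k.+1%:R)))); last first.
    by rewrite ler_wpM2l ?exprn_ge0 ?(le_trans _ B1)// ler_wpM2l// dP.
  rewrite exprS /X.
  have -> : K * (L ^+ 2 * k.+1%:R ^+ 2 * B ^+ k) =
    (K * L ^+ 2 / d) * (B ^+ k * (k.+1%:R * (d * k.+1%:R))).
    by field; rewrite gt_eqF.
  rewrite -[B * _ * _]mulrA ler_wpM2r ?lerDr//.
  by rewrite !mulr_ge0// ltW.
exists B^-1; first by rewrite invr_gt0 (lt_le_trans _ B1).
exists 1 => k; rewrite exprVn ler_pdivrMr ?mul1r//.
by rewrite exprn_gt0// (lt_le_trans _ B1).
Qed.

End Frobenius.

Section FrobeniusSolution.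
Context {R : realType}.
Implicit Types (b f : nat -> R[i]) (u s lam mu : R[i]) (r : R).

Lemma coef_bounded_exponent b lam r t : 0 <= t < r -> coef_bounded b r ->
  coef_bounded (fun k => (lam - k%:R) * b k) t.
Proof.
move=> /andP[t0 tr] bb.
have -> : (fun k => (lam - k%:R) * b k) = (fun k => lam * b k - k%:R * b k).
  by apply/funext => k; rewrite mulrBl.
apply: coef_boundedB => //.
  by apply: coef_boundedZ; apply: coef_bounded_small bb; rewrite t0 ltW.
by apply: coef_bounded_natr bb; rewrite t0.
Qed.

Definition frob b lam s := cexp (lam * s) * psum b (cexp (- s)).

(** The k-th term is b k exp ((lam - k) s), so d/ds multiplies the k-th coefficient by lam - k. *)
Lemma is_derive_frob b lam r s : coef_bounded b r -> normc (cexp (- s)) < r ->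
  is_derive s 1 (frob b lam) (frob (fun k => (lam - k%:R) * b k) lam s).
Proof.
move=> bb ur; have r0 : 0 < r by exact: le_lt_trans (normc_ge0 _) ur.
have dN : is_derive s 1 (fun v : R[i] => cexp (- v)) (- cexp (- s)).
  by apply: (is_derive_compc _ (is_derive_cexp _)); rewrite mulrN1.
have dL : is_derive s 1 (fun v : R[i] => cexp (lam * v)) (lam * cexp (lam * s)).
  apply: (is_derive_compc (f := fun v => lam * v) (df := lam) _ (is_derive_cexp _)).
    have := is_deriveZ (f := id) lam (is_derive_id s 1).
    by rewrite /GRing.scale/= mulr1.
  by rewrite mulrC.
have dP := is_derive_compc dN (is_derive_psum bb ur) erefl.
have := is_deriveM dL dP; rewrite /frob.
set u := cexp (- s) in ur *; set e := cexp (lam * s).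
pose t := (normc u + r) / 2.
have ut : normc u < t by rewrite /t; lra.
have tr : t < r by rewrite /t; lra.
have t0 : 0 < t by exact: le_lt_trans (normc_ge0 _) ut.
have bt : coef_bounded b t by apply: coef_bounded_small bb; rewrite !ltW.
have kb : coef_bounded (fun k => k%:R * b k) t.
  by apply: coef_bounded_natr bb; rewrite (ltW t0).
have -> : (fun k => (lam - k%:R) * b k) = (fun k => lam * b k - k%:R * b k).
  by apply/funext => k; rewrite mulrBl.
rewrite (psumB (coef_boundedZ lam bt) kb ut) (psumZ lam bt ut) (psum_shift kb ut).
rewrite mul0r add0r => H; apply: (is_derive_eq H); rewrite /GRing.scale/=.
by move: (psum b u) (psum _ u) => x y; ring.
Qed.

(** [k0] and [k1] are the power series in u = 1/z of the solution and of its s-derivative. Their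
    values at 0 are recorded because they decide later whether two solutions are independent. *)
Lemma frobenius_solution (a c lam : R[i]) : lam ^+ 2 - lam + c * (a - 1) = 0 ->
  (forall k, (0 < k)%N -> k%:R != 2 * lam - 1) ->
  exists (r : R) (k0 k1 : R[i] -> R[i]),
  [/\ 0 < r, k0 0 = 1 /\ k1 0 = lam,
      {for 0, continuous k0} /\ {for 0, continuous k1} &
      forall s, normc (cexp (- s)) < r ->
        is_derive s 1 (fun v => cexp (lam * v) * k0 (cexp (- v)))
          (cexp (lam * s) * k1 (cexp (- s))) /\
        exists2 f2, is_derive s 1 (fun v => cexp (lam * v) * k1 (cexp (- v))) f2 &
          let u := cexp (- s) in
          let f0 := cexp (lam * s) * k0 u in let f1 := cexp (lam * s) * k1 u in
          (1 - u ^+ 2) * (1 - a ^+ 2 * u ^+ 2) * (f2 - f1) =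
          (a - 1) * (1 + a * u ^+ 2) * (u * f1 - c * f0)].
Proof.
move=> lam0 lamN; have [b [b0 [r r0 br] bE]] := frobenius_coef lam0 lamN.
pose b1 k := (lam - k%:R) * b k; pose b2 k := (lam - k%:R) * b1 k.
(* Each derivative multiplies the coefficients by lam - k and costs some radius. *)
have [r1 r10 r1r] : exists2 r1, 0 < r1 & r1 < r by exists (r / 2); lra.
have [r2 r20 r2r1] : exists2 r2, 0 < r2 & r2 < r1 by exists (r1 / 2); lra.
have b1r : coef_bounded b1 r1.
  by apply: coef_bounded_exponent br; rewrite (ltW r10).
have b2r : coef_bounded b2 r2.
  by apply: coef_bounded_exponent b1r; rewrite (ltW r20).
have bt : coef_bounded b r2.
  by apply: coef_bounded_small br; rewrite (ltW r20) ltW// (lt_trans r2r1).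
have b1t : coef_bounded b1 r2.
  by apply: coef_bounded_small b1r; rewrite (ltW r20) ltW.
exists r2, (psum b), (psum b1); split=> //.
- by rewrite (psum0 r20 bt) (psum0 r20 b1t) /b1 b0 subr0 mulr1.
- split; apply: is_derive_continuous; apply: is_derive_psum; first exact: bt.
  + by rewrite normc0.
  + exact: b1t.
  + by rewrite normc0.
move=> s ur; split; first exact: is_derive_frob bt ur.
exists (frob b2 lam s); first exact: is_derive_frob b1t ur.
rewrite /frob; set u := cexp (- s) in ur *.
pose p k := b2 k - b1 k.
have pt : coef_bounded p r2 by apply: coef_boundedB => //; rewrite ltW.
have pE k : (lam - k%:R) * (lam - k%:R - 1) * b k = p k.
  by rewrite /p /b2 /b1; ring.
have psumE : psum p u = psum b2 u - psum b1 u by exact: psumB b2r b1t ur.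
clearbody p.
have D d (dt : coef_bounded d r2) : coef_bounded (delay d) r2.
  by apply: coef_bounded_delay; rewrite ?ltW.
have Z z d (dt : coef_bounded d r2) := coef_boundedZ z dt.
have P d (dt : coef_bounded d r2) e (et : coef_bounded e r2) :=
  coef_boundedD (ltW r20) dt et.
have M d (dt : coef_bounded d r2) e (et : coef_bounded e r2) :=
  coef_boundedB (ltW r20) dt et.
have SD d (dt : coef_bounded d r2) : psum (delay d) u = u * psum d u :=
  psum_delay dt ur.
have SZ z d (dt : coef_bounded d r2) : psum (fun k => z * d k) u =
  z * psum d u := psumZ z dt ur.
have SP d e (dt : coef_bounded d r2) (et : coef_bounded e r2) :
  psum (fun k => d k + e k) u = psum d u + psum e u := psumD dt et ur.
have SM d e (dt : coef_bounded d r2) (et : coef_bounded e r2) :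
  psum (fun k => d k - e k) u = psum d u - psum e u := psumB dt et ur.
(* Summing the recurrence against u^k turns each delay into a factor u and yields the differential
   equation divided by exp (lam s). *)
have : psum (fun k => p k + c * (a - 1) * b k) u = psum (frob_rhs a c lam b) u.
  by congr (psum _ u); apply/funext => k; rewrite -bE pE.
have -> : frob_rhs a c lam b = (fun k =>
  (1 + a ^+ 2) * delay (delay p) k - a ^+ 2 * delay (delay (delay (delay p))) k
  + (a - 1) * delay b1 k + (a - 1) * a * delay (delay (delay b1)) k
  - (a - 1) * a * c * delay (delay b) k).
  apply/funext => k; rewrite /frob_rhs.
  by have -> : (fun j => (lam - j%:R) * (lam - j%:R - 1) * b j) = p by apply/funext.
have q1 := Z (1 + a ^+ 2) _ (D _ (D _ pt)).
have q2 := Z (a ^+ 2) _ (D _ (D _ (D _ (D _ pt)))).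
have q3 := Z (a - 1) _ (D _ b1t).
have q4 := Z ((a - 1) * a) _ (D _ (D _ (D _ b1t))).
have q5 := Z ((a - 1) * a * c) _ (D _ (D _ bt)).
have q12 := M _ q1 _ q2; have q13 := P _ q12 _ q3; have q14 := P _ q13 _ q4.
rewrite (SP _ _ pt (Z _ _ bt)) (SZ _ _ bt) (SM _ _ q14 q5) (SP _ _ q13 q4).
rewrite (SP _ _ q12 q3) (SM _ _ q1 q2) (SZ _ _ (D _ (D _ pt))).
rewrite (SZ _ _ (D _ (D _ (D _ (D _ pt))))) (SZ _ _ (D _ b1t)).
rewrite (SZ _ _ (D _ (D _ (D _ b1t)))) (SZ _ _ (D _ (D _ bt))).
rewrite (SD _ (D _ (D _ (D _ pt)))) (SD _ (D _ (D _ pt))) (SD _ (D _ pt)) (SD _ pt).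
rewrite (SD _ (D _ (D _ b1t))) (SD _ (D _ b1t)) (SD _ b1t) (SD _ (D _ bt)) (SD _
  bt).
rewrite psumE; move: (psum b u) (psum b1 u) (psum b2 u) (cexp _) => x x1 x2 e.
move=> H; apply/eqP; rewrite -subr_eq0; apply/eqP.
move: H => /eqP; rewrite -subr_eq0 => /eqP H.
rewrite -[RHS](mulr0 e) -[in RHS]H; ring.
Qed.

End FrobeniusSolution.

(** * Calculus: functions with zero derivative, local constancy, branches of the square root *)

Section Calculus.
Context {R : realType}.
Implicit Types (f g k q : R[i] -> R[i]) (z v d h : R[i]).

Lemma is_derive_inv f z d : f z != 0 -> is_derive z 1 f d ->
  is_derive z 1 (fun v => (f v)^-1) (- d / f z ^+ 2).
Proof.
move=> fz [df fd]; apply: DeriveDef; first exact: derivableV.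
by rewrite deriveV// fd /GRing.scale/= mulNr mulrC mulNr.
Qed.

Lemma is_derive_mul f g z df dg : is_derive z 1 f df -> is_derive z 1 g dg ->
  is_derive z 1 (fun v => f v * g v) (f z * dg + g z * df).
Proof. exact: is_deriveM. Qed.

Lemma is_derive_sub f g z df dg : is_derive z 1 f df -> is_derive z 1 g dg ->
  is_derive z 1 (fun v => f v - g v) (df - dg).
Proof. exact: is_deriveB. Qed.

Lemma is_derive_mx m n (M : R[i] -> 'M[R[i]]_(m, n)) z D i j :
  is_derive z 1 M D -> is_derive z 1 (fun v => M v i j) (D i j).
Proof.
move=> [Mz MD].
have Mc : h^-1 *: (M (h *: 1 + z) - M z) @[h --> 0^'] --> D by rewrite -MD;
  exact: Mz.
have cM : h^-1 *: (M (h *: 1 + z) i j - M z i j) @[h --> 0^'] --> D i j.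
  have H := continuous_cvg _ (@coord_continuous _ m n i j D) Mc.
  have {}H := H (dnbhs_filter _); apply: cvg_trans H; apply: near_eq_cvg; near=> h.
  by rewrite /= !mxE.
by apply: DeriveDef; [apply/cvg_ex; exists (D i j)|exact: cvg_lim cM].
Unshelve. all: by end_near. Qed.

(** The real mean value theorem on the segment from z to v, for real and imaginary parts
    separately. *)
Lemma derive0_cst_ball k z (r : R) :
  (forall v, normc (v - z) < r -> is_derive v 1 k 0) ->
  forall v, normc (v - z) < r -> k v = k z.
Proof.
move=> k0 v vr; pose h := v - z.
have inr (x : R) : x \in `[0, 1] -> normc (z + x%:C * h - z) < r.
  rewrite in_itv/= => /andP[x0 x1]; rewrite addrAC subrr add0r normcM normc_real.
  by rewrite ger0_norm//; apply: le_lt_trans vr; rewrite ler_piMl ?normc_ge0.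
(* [H] stands for [Re] or [Im]: compatibility with differences and the bound by the modulus are all
   that is used. *)
have key (H : R[i] -> R) : (forall u, `|H u| <= normc u) ->
    (forall u w, H (u - w) = H u - H w) -> H (k v) = H (k z).
  move=> Hn HB; pose phi (x : R) := H (k (z + x%:C * h)).
  have dphi (x : R) : x \in `[0, 1] -> is_derive x 1 phi 0.
    move=> /inr/k0/is_derive_complexP kx; apply/is_derive_normP => e e0.
    have h1 : 0 < 1 + normc h by rewrite ltr_pwDl ?normc_ge0.
    have [s s0 ks] := kx _ (divr_gt0 e0 h1).
    exists (s / (1 + normc h)) => [|y yx]; first by rewrite divr_gt0.
    have E : z + y%:C * h - (z + x%:C * h) = (y - x)%:C * h.
      by rewrite rmorphB/=; move: y%:C x%:C => p q; ring.
    have := ks (z + y%:C * h); rewrite E normcM normc_real !mulr0 !subr0 => kE.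
    rewrite /phi -HB; apply: le_trans (Hn _) _; apply: le_trans (kE _) _.
      move: yx; rewrite ltr_pdivlMr//; apply: le_lt_trans.
      by rewrite ler_wpM2l// lerDr.
    rewrite mulrAC mulrA -mulrA [X in X <= _](_ : _ =
      e * `|y - x| * (normc h / (1 + normc h))).
      by rewrite ler_piMr ?mulr_ge0 ?(ltW e0)// ler_pdivrMr// mul1r lerDr.
    by ring.
  have cphi : {within `[0, 1], continuous phi}.
    by apply: derivable_within_continuous => x /dphi[].
  have ophi (x : R) : x \in `]0, 1[ -> is_derive x 1 phi ((fun=> 0 : R) x).
    by move=> x01; apply: dphi; move: x01;
      rewrite !in_itv/= => /andP[/ltW-> /ltW->].
  have [x _] := MVT ltr01 ophi cphi.
  rewrite mul0r /phi mul1r mul0r addr0 [z + h]addrC subrK.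
  by move=> /eqP; rewrite subr_eq0 => /eqP.
have Rek := key _ Re_le_normc.
have Imk := key _ Im_le_normc.
move: Rek Imk; case: (k v) (k z) => p q [p' q'] /= Rek Imk.
by congr (_ +i* _); [apply: Rek => -[? ?] [? ?]|apply: Imk => -[? ?] [? ?]].
Qed.

(** The set where h = h 0 and its complement are both relatively open in the connected segment. *)
Lemma locally_constant_segment (T : Type) (h : R -> T) :
  (forall t : R, t \in `[0, 1] ->
    \forall u \near t, u \in `[0, 1] -> h u = h t) -> h 1 = h 0.
Proof.
move=> hl; pose I := [set` `[0 : R, 1]].
pose C := [set t : R | \forall u \near t, u \in `[0, 1] -> h u = h 0].
pose N := [set t : R | \forall u \near t, u \in `[0, 1] -> h u <> h 0].
have oC : open C by exact: open_interior [set u : R | u \in `[0, 1] -> h u = h 0].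
have oN : open N by exact: open_interior [set u : R | u \in `[0, 1] -> h u <> h 0].
have I0 : (0 : R) \in `[0, 1] by rewrite in_itv/= lexx ler01.
have I1 : (1 : R) \in `[0, 1] by rewrite in_itv/= lexx ler01.
have CP t : t \in `[0, 1] -> C t <-> h t = h 0.
  move=> tI; split=> [/nbhs_singleton/(_ tI)//|t0].
  by rewrite /C/= -t0; exact: hl.
have NP t : t \in `[0, 1] -> N t <-> h t <> h 0.
  move=> tI; split=> [/nbhs_singleton/(_ tI)//|t0].
  by apply: filterS (hl t tI) => u ut uI; rewrite ut.
have E : I `&` C = I.
  apply: (@segment_connected R 0 1).
- by exists 0; split; [exact: I0|apply/(CP _ I0)].
- by exists C.
- exists (~` N); first exact: open_closedC.
  apply/seteqP; split=> t [tI tC]; split=> //.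
    by move=> /(NP t tI); apply; apply/(CP t tI).
  by apply/(CP t tI); apply: contrapT => /(NP t tI).
have : (I `&` C) 1 by rewrite E; exact: I1.
by move=> [_ /(CP _ I1)].
Qed.

(** Values within 1 / 2 of e have a sum of modulus at least 1, so f v - f z = (q v - q z) / (f v + f
    z) is controlled by the increment of q. *)
Lemma is_derive_sqrt_branch (f q : R[i] -> R[i]) z d e :
  e ^+ 2 = 1 -> is_derive z 1 q d ->
  (\forall v \near z, f v ^+ 2 = q v /\ normc (f v - e) < 1 / 2) ->
  is_derive z 1 f (d / (2 * f z)).
Proof.
move=> e2 qd fq; have [_ fze] := nbhs_singleton fq.
have e1 := normc_sqr1 e2.
have near_e w w' : normc (w - e) < 1 / 2 -> normc (w' - e) < 1 / 2 ->
    1 <= normc (w + w').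
  move=> we w'e.
  have := normc_triangle (w + w') (- (w - e) - (w' - e)).
  have -> : w + w' + (- (w - e) - (w' - e)) = 2 * e by ring.
  have -> : normc (2 * e) = 2.
    by rewrite normcM e1 mulr1 -(rmorph_nat (real_complex R)) normc_real normr_nat.
  have := normc_triangle (- (w - e)) (- (w' - e)); rewrite !normc_opp; lra.
have fz2 : 1 <= normc (2 * f z) by rewrite mulr_natl mulr2n; exact: near_e.
have fz0 : f z != 0.
  by apply/eqP => f0; move: fz2; rewrite f0 mulr0 normc0 ler10.
have := is_derive_continuous qd => /cvg_complexP qc.
have /is_derive_complexP qz := qd.
apply/is_derive_complexP => eps eps0.
pose nd := normc d; have nd0 : 0 <= nd := normc_ge0 _.
have e20 : 0 < eps / 2 by rewrite divr_gt0.
have e30 : 0 < eps / 2 / (1 + nd) by rewrite divr_gt0// ltr_pwDl.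
have [r1 r10 qr1] := qz _ e20.
have /near_complexP[r2 r20 qr2] := qc _ e30.
have /near_complexP[r3 r30 fr3] := fq.
exists (Num.min r1 (Num.min r2 r3)); first by rewrite !lt_min r10 r20.
move=> v; rewrite !lt_min => /and3P[/qr1 v1 /qr2 v2 /fr3[fv fve]].
have [fz_ _] := nbhs_singleton fq.
have fvz := near_e _ _ fve fze.
have n0 : 0 < normc (f v + f z) by apply: lt_le_trans fvz.
have fvz0 : f v + f z != 0 by rewrite -normc_gt0.
have f1 : normc (f v - f z) <= normc (q v - q z).
  rewrite -fv -fz_ (_ : _ ^+ 2 - _ ^+ 2 = (f v - f z) * (f v + f z)); last by ring.
  by rewrite normcM ler_peMr ?normc_ge0.
have -> : f v - f z - (v - z) * (d / (2 * f z)) =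
  ((q v - q z - (v - z) * d) - (v - z) * d * ((f v - f z) / (2 * f z))) / (f v +
    f z).
  rewrite -fv -fz_; move: (v - z) (f v) (f z) fvz0 fz0 => D p p' pp p0.
  by field; rewrite pp p0.
rewrite normcM normcV ler_pdivrMr//.
apply: (@le_trans _ _ (eps * normc (v - z))); last first.
  by rewrite ler_peMr// mulr_ge0 ?normc_ge0// ltW.
apply: le_trans (normc_triangle _ _) _.
rewrite normc_opp [eps in X in _ <= X]splitr [X in _ <= X]mulrDl; apply: lerD => //.
rewrite normcM [normc ((v - z) * d)]normcM.
have fr : normc ((f v - f z) / (2 * f z)) <= eps / 2 / (1 + nd).
  rewrite normcM normcV ler_pdivrMr; last exact: lt_le_trans fz2.
  apply: le_trans (le_trans f1 (ltW v2)) _.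
  by rewrite ler_peMr// ltW.
apply: (@le_trans _ _ (normc (v - z) * nd * (eps / 2 / (1 + nd)))).
  by rewrite ler_wpM2l// mulr_ge0// normc_ge0.
rewrite [X in X <= _](_ : _ = eps / 2 * normc (v - z) * (nd / (1 + nd)));
  last by ring.
rewrite ler_piMr ?(mulr_ge0 (ltW e20)) ?normc_ge0//.
by rewrite ler_pdivrMr ?ltr_pwDl// mul1r lerDr.
Qed.

End Calculus.

(** * Local solutions on the cover *)

Section LocalGeometry.
Context {R : realType}.
Implicit Types (z w v e b : R[i]) (a c : R).

(** If (w - z) (w + z) has modulus below d^2, one of the factors has modulus below d, so w or - w is
    the required root. This covers z = 0 as well. *)
Lemma sqrt_near z (d : R) : 0 < d -> exists2 r : R, 0 < r &
  forall v, normc (v - z ^+ 2) < r -> exists2 w, w ^+ 2 = v & normc (w - z) < d.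
Proof.
move=> d0; exists (d ^+ 2); first by rewrite exprn_gt0.
move=> v vz; pose w := sqrtc v; have wv : w ^+ 2 = v := sqr_sqrtc v.
have : normc (w - z) * normc (w + z) < d ^+ 2.
  by rewrite -normcM (_ : _ * _ = v - z ^+ 2)// -wv; ring.
case: (ltP (normc (w - z)) d) => [wz _|wz wd]; first by exists w.
exists (- w); first by rewrite sqrrN.
rewrite -opprD normc_opp; rewrite ltNge; apply/negP => dw.
by move: wd; rewrite ltNge expr2 ler_pM// ltW.
Qed.

Lemma near_sphere_pair (P : set (sphere R * sphere R)) z w :
  nbhs ((Some z, Some w) : sphere R * sphere R) P ->
  exists2 d : R, 0 < d & forall v u, normc (v - z) < d -> normc (u - w) < d ->
    P (Some v, Some u).
Proof.
move=> [[A B] /= [Az Bw] ABP].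
have /near_complexP[d1 d10 dA] : \forall v \near z, A (Some v) by exact: Az.
have /near_complexP[d2 d20 dB] : \forall v \near w, B (Some v) by exact: Bw.
exists (Num.min d1 d2); first by rewrite lt_min d10.
move=> v u; rewrite !lt_min => /andP[v1 _] /andP[_ u2].
by apply: ABP; split; [exact: dA|exact: dB].
Qed.

Definition ratc a z : R[i] := (z + 1) * (z - a%:C) / ((z - 1) * (z + a%:C)).

Lemma is_derive_translation z b : is_derive z 1 (fun v : R[i] => v + b) 1.
Proof.
have := is_deriveD (is_derive_id z (1 : R[i])) (is_derive_cst b z (1 : R[i])).
by rewrite addr0.
Qed.

Lemma is_derive_ratc a z : (z - 1) * (z + a%:C) != 0 ->
  is_derive z 1 (ratc a)
    (2 * (a%:C - 1) * (z ^+ 2 + a%:C) / ((z - 1) * (z + a%:C)) ^+ 2).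
Proof.
move=> den0.
have dB := is_derive_translation z.
have dnum := is_derive_mul (dB 1) (dB (- a%:C)).
have dinv := is_derive_inv (f := fun v => (v - 1) * (v + a%:C)) den0
  (is_derive_mul (dB (- 1)) (dB a%:C)).
apply: (is_derive_eq (is_derive_mul dnum dinv)).
move: den0; rewrite mulf_eq0 negb_or => /andP[z1 za].
by move: (a%:C) z1 za => b z1 zb; field; rewrite z1 zb.
Qed.

Lemma surfaceM_Some a z w : surfaceM a (Some z, Some w) <->
  (z - 1) * (z + a%:C) != 0 /\ w ^+ 2 = ratc a z.
Proof.
rewrite /surfaceM /ratio /ratc /=; case: ifPn => [/eqP d0|d0]; split.
- by move=> [].
- by move=> [/eqP].
- by move=> [[wz] _]; split.
- by move=> [_ ->]; split => // -[].
Qed.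

(* The value of w at z on the sheet where w is close to e, for e = 1 or -1,
   and 0 if there is none. *)
Definition branch a e z : R[i] :=
  xget 0 [set w | w ^+ 2 = ratc a z /\ normc (w - e) < 1 / 2].

Lemma branch_neq0 e w : e ^+ 2 = 1 -> normc (w - e) < 1 / 2 -> w != 0.
Proof.
move=> /normc_sqr1 e1 we; apply/eqP => w0; move: we.
by rewrite w0 add0r normc_opp e1; lra.
Qed.

Lemma branchE a e z w : e ^+ 2 = 1 -> w ^+ 2 = ratc a z ->
  normc (w - e) < 1 / 2 -> branch a e z = w.
Proof.
move=> e2 wz we; rewrite /branch; apply: xget_unique; first by split.
move=> w' [w'z w'e]; apply/eqP.
have : (w' == w) || (w' == - w) by rewrite -eqf_sqr w'z wz.
case/orP => // /eqP w'w; exfalso; move: w'e; rewrite w'w -opprD normc_opp => w'e.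
have := normc_triangle (w + e) (- (w - e)).
have -> : w + e + - (w - e) = 2 * e by ring.
rewrite normcM (normc_sqr1 e2) mulr1 normc_opp.
by rewrite -(rmorph_nat (real_complex R)) normc_real normr_nat; lra.
Qed.

Context (T : topologicalType) (p : T -> sphere R * sphere R).

(** The map from the cover to z is open at x: nearby v carry a value of w close to the given one,
    and the sheet through x lifts the pair. Identities that hold near x on the cover thus become
    identities near z in the plane. *)
Lemma cover_local_lift a x (V : set T) z w : covering_map (surfaceM a) p ->
  p x = (Some z, Some w) -> nbhs x V ->
  \forall v \near z, exists2 y, V y & exists u, p y = (Some v, Some u).
Proof.
move=> [pc pM pcov] px Vx.
have Mx : surfaceM a (p x) by rewrite -pM; exists x.
have [N [oN Nx [I [W [WE _ _ Ws]]]]] := pcov _ Mx.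
have [i _ Wx] : (\bigcup_i W i) x by rewrite -WE.
have [s [sc sU sW]] := Ws i.
have : s @ within (surfaceM a `&` N) (nbhs (p x)) --> s (p x).
  by move/subspace_continuousP : sc; apply; split.
rewrite sW// => /(_ _ Vx) sV'.
have sV : \forall u \near p x, (surfaceM a `&` N) u -> V (s u) by exact: sV'.
rewrite px in sV.
have On : nbhs ((Some z, Some w) : sphere R * sphere R) N.
  by rewrite -px; exact: open_nbhs_nbhs.
have [d d0 dP] := near_sphere_pair (filterI sV On).
have [r r0 rP] := sqrt_near w d0.
move: Mx; rewrite px => /surfaceM_Some[zd wz].
have zdn : \forall v \near z, (v - 1) * (v + a%:C) != 0.
  have c := is_derive_continuous (is_derive_mul
    (is_derive_translation z (- 1)) (is_derive_translation z a%:C)).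
  have n0 : 0 < normc ((z - 1) * (z + a%:C)) by rewrite normc_gt0.
  move/cvg_complexP : c => /(_ _ n0); apply: filterS => v.
  by apply: contraTneq => ->; rewrite sub0r normc_opp ltxx.
have /is_derive_continuous/cvg_complexP/(_ _ r0) rc := is_derive_ratc zd.
have zn : \forall v \near z, normc (v - z) < d by apply/near_complexP; exists d.
near=> v.
have vd : normc (v - z) < d by near: v.
have [|u uv uw] := rP (ratc a v).
  by rewrite wz; near: v.
have [sVu Ou] := dP v u vd uw.
have Mu : surfaceM a (Some v, Some u).
  by apply/surfaceM_Some; split => //; near: v.
have U : (surfaceM a `&` N) (Some v, Some u) by split.
by exists (s (Some v, Some u)); [exact: sVu|exists u; have [] := sU _ U].
Unshelve. all: by end_near. Qed.

End LocalGeometry.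

Section LocalSolution.
Context {R : realType}.
Implicit Types (z w v e s : R[i]) (a c : R).
Context (T : topologicalType) (p : T -> sphere R * sphere R).
Context (F : T -> 'M[R[i]]_2).

Definition dz_coef c w : 'M[R[i]]_2 := c%:C *: mx2 1 (- w) w^-1 (-1).

(** [has_dz_derivative] gives a local function of z, different for each point, and its derivative at
    that point only. Here a single function serves a whole neighbourhood of z. *)
Lemma local_solution a c e x z w : e ^+ 2 = 1 ->
  covering_map (surfaceM a) p -> weierstrass_solution p F c ->
  p x = (Some z, Some w) -> normc (w - e) < 1 / 2 ->
  exists Fh : R[i] -> 'M[R[i]]_2,
    (\forall y \near x, F y = Fh (zcoord (p y))) /\
    \forall v \near z,
      [/\ (v - 1) * (v + a%:C) != 0, branch a e v ^+ 2 = ratc a v,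
          normc (branch a e v - e) < 1 / 2 &
          is_derive v 1 Fh (dz_coef c (branch a e v) *m Fh v)].
Proof.
move=> e2 pcov [_ _ Fdz] px we; have [pc pM _] := pcov.
have [Fh [FV _]] := Fdz x w (congr1 snd px) (branch_neq0 e2 we).
exists Fh; split => //.
have Wx : \forall y \near x, forall u, (p y).2 = Some u -> normc (u - e) < 1 / 2.
  have Q : nbhs (p x) [set q | forall u, q.2 = Some u -> normc (u - e) < 1 / 2];
    last exact: pc Q.
  exists (setT, [set q : sphere R | forall u, q = Some u -> normc (u - e) < 1 / 2]).
    split; [exact: filterT|rewrite px /=].
    suff : \forall u \near w, normc (u - e) < 1 / 2.
      by move=> H; apply: filterS H => u ue _ [<-].
    apply/near_complexP; exists (1 / 2 - normc (w - e)); first by rewrite subr_gt0.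
    move=> u; rewrite ltrBrDr => uw; apply: le_lt_trans uw.
    by have := normc_triangle (u - w) (w - e); rewrite addrA subrK.
  by move=> q [_ /= qe].
have V0 : nbhs x [set y | nbhs y [set y' | F y' = Fh (zcoord (p y'))] /\
    forall u, (p y).2 = Some u -> normc (u - e) < 1 / 2].
  by apply: filterI => //; exact: nbhs_interior FV.
apply: filterS (cover_local_lift pcov px V0) => v [y [Vy ye] [u py]].
have /surfaceM_Some[vd uv] : surfaceM a (Some v, Some u).
  by rewrite -py -pM; exists y.
have ue : normc (u - e) < 1 / 2 by apply: ye; rewrite py.
have bE := branchE e2 uv ue.
rewrite bE; split => //.
have [Fy [FVy Fyd]] := Fdz y u (congr1 snd py) (branch_neq0 e2 ue).
move: Fyd; rewrite (nbhs_singleton Vy) py /= => Fyd.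
(* The local functions attached to [x] and to [y] both represent [F] near [y], so they agree near
   v. *)
apply: near_eq_is_derive Fyd.
apply: filterS (cover_local_lift pcov py (filterI Vy FVy)) => v' [y' [h1 h2] [u'
  py']].
by move: h1 h2 => /= -> ; rewrite py'.
Qed.

(* The system is trace-free, so the Wronskian of two solutions is constant. *)
Lemma wronskian_locally_constant a c e x s0 w (f g : R[i] ->
  R[i]) (j : 'I_2) : e ^+ 2 = 1 ->
  covering_map (surfaceM a) p -> weierstrass_solution p F c ->
  p x = (Some (cexp s0), Some w) -> normc (w - e) < 1 / 2 ->
  (\forall s \near s0,
     is_derive (s : R[i]) 1 f (cexp s * c%:C * (f s - branch a e (cexp s) * g s)) /\
     is_derive (s : R[i]) 1 g (cexp s * c%:C * (f s / branch a e (cexp s) - g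
       s))) ->
  exists (V : set T) (r : R), [/\ nbhs x V, 0 < r &
    forall y s, V y -> normc (s - s0) < r -> (p y).1 = Some (cexp s) ->
      f s * F y 1 j - g s * F y 0 j = f s0 * F x 1 j - g s0 * F x 0 j].
Proof.
move=> e2 pcov Fsol px we fg.
have [Fh [FV Fhd]] := local_solution e2 pcov Fsol px we.
have /cvg_complexP cc := is_derive_continuous (is_derive_cexp s0).
pose k s := f s * Fh (cexp s) 1 j - g s * Fh (cexp s) 0 j.
have /near_complexP[r0 r00 Fr0] := Fhd.
have kd : \forall s \near s0, is_derive (s : R[i]) 1 k 0.
  have cn := cc _ r00.
  near=> s; have [fd gd] : is_derive s 1 f (cexp s * c%:C * (f s - branch a e
    (cexp s) * g s)) /\
     is_derive (s : R[i]) 1 g (cexp s * c%:C * (f s / branch a e (cexp s) - g s))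
       by near: s.
  have [|_ _ _ Fd] := Fr0 (cexp s); first by near: s.
  have d0 := is_derive_mx 0 j Fd; have d1 := is_derive_mx 1 j Fd.
  have c0 := is_derive_compc (is_derive_cexp s) d0 erefl.
  have c1 := is_derive_compc (is_derive_cexp s) d1 erefl.
  apply: (is_derive_eq (is_derive_sub (is_derive_mul fd c1) (is_derive_mul gd c0))).
  rewrite /dz_coef !mxE !big_ord_recl !big_ord0 !mxE /= !addr0.
  have -> : lift ord0 ord0 = 1 :> 'I_2 by exact: val_inj.
  move: (f s) (g s) (Fh (cexp s) 0 j) (Fh (cexp s) 1 j) (cexp s) (branch _ _ _)
    ((branch _ _ _)^-1) c%:C.
  by move=> A B X Y E W W' C; ring.
have /near_complexP[r r1 kr] := kd.
exists [set y | F y = Fh (zcoord (p y))], r; split => // y s Fy sr py1.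
have Fx := nbhs_singleton FV; rewrite /= in Fx Fy.
have := derive0_cst_ball kr sr.
by rewrite /k Fx Fy px {1 2}/zcoord /= {1 2}/zcoord py1.
Unshelve. all: by end_near. Qed.

End LocalSolution.

(** * From the scalar equation back to the first-order system *)

Section FrobeniusSystem.
Context {R : realType}.
Implicit Types (z w v e s : R[i]) (a c : R).

Definition sol_fst (k0 : R[i] -> R[i]) lam s : R[i] :=
  cexp (lam * s) * k0 (cexp (- s)).

(* Y is recovered from X by X' = c (X - w Y), where dX/dz = e^(-s) dX/ds. *)
Definition sol_snd a c e (k0 k1 : R[i] -> R[i]) lam s : R[i] :=
  (sol_fst k0 lam s - sol_fst k1 lam s * cexp (- s) / c%:C) /
  branch a e (cexp s).

(** The first equation holds by the choice of the second component. The second one is the scalar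
    equation: the derivative of the branch follows from w^2 = [ratc a z], and w enters only through
    its square and an overall factor 1/w. *)
Lemma frobenius_system a c lam : c != 0 ->
  lam ^+ 2 - lam + c%:C * (a%:C - 1) = 0 ->
  (forall k, (0 < k)%N -> k%:R != 2 * lam - 1) ->
  exists (r : R) (k0 k1 : R[i] -> R[i]),
  [/\ 0 < r, k0 0 = 1 /\ k1 0 = lam,
      {for 0, continuous k0} /\ {for 0, continuous k1} &
      forall e s, e ^+ 2 = 1 -> normc (cexp (- s)) < r ->
        (\forall v \near cexp s, [/\ (v - 1) * (v + a%:C) != 0,
           branch a e v ^+ 2 = ratc a v & normc (branch a e v - e) < 1 / 2]) ->
        let f := sol_fst k0 lam in let g := sol_snd a c e k0 k1 lam in
        is_derive s 1 f (cexp s * c%:C * (f s - branch a e (cexp s) * g s)) /\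
        is_derive s 1 g (cexp s * c%:C * (f s / branch a e (cexp s) - g s))].
Proof.
move=> c0 lam0 lamN; have [r [k0 [k1 [r0 k00 kc kd]]]] :=
  frobenius_solution lam0 lamN.
exists r, k0, k1; split=> // e s e2 ur bs f g.
have [fd [f2 f1d fode]] := kd s ur; rewrite /= in fode.
have [den0 wz we] := nbhs_singleton bs.
have w0 := branch_neq0 e2 we.
have cC : c%:C != 0 by rewrite (inj_eq (@complexI R)).
pose f1 := sol_fst k1 lam.
have z0 := cexp_neq0 s; have uE := cexpN s.
have fE : cexp s * c%:C * (f s - branch a e (cexp s) * g s) = f1 s.
  rewrite /g /sol_snd -/f -/f1 uE.
  move: c%:C cC (f s) (f1 s) (cexp s) z0 (branch a e (cexp s)) w0.
  move=> C C0 x y z z0 w w0.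
  by field; rewrite ?w0 ?z0 ?C0.
rewrite fE; split; first exact: fd.
have dN : is_derive s 1 (fun v => cexp (- v)) (- cexp (- s)).
  by apply: (is_derive_compc _ (is_derive_cexp _)); rewrite mulrN1.
have dn : is_derive s 1 (fun v => f v - f1 v * cexp (- v) / c%:C)
   (f1 s - (f2 - f1 s) * cexp (- s) / c%:C).
  have dc := is_derive_cst c%:C^-1 s (1 : R[i]).
  apply: (is_derive_eq (is_derive_sub fd (is_derive_mul (is_derive_mul f1d dN)
    dc))).
  rewrite /f1 /sol_fst /cst; move: (cexp (- s)) (cexp (lam * s)) (k1 (cexp (-
    s))) (c%:C^-1) => u x y C.
  by ring.
have db : is_derive (cexp s) 1 (branch a e)
    (2 * (a%:C - 1) * (cexp s ^+ 2 + a%:C) / ((cexp s - 1) * (cexp s + a%:C)) ^+ 2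
     / (2 * branch a e (cexp s))).
  apply: is_derive_sqrt_branch e2 (is_derive_ratc den0) _.
  by apply: filterS bs => v [].
have dbc := is_derive_compc (is_derive_cexp s) db erefl.
have di := is_derive_inv (f := fun v => branch a e (cexp v)) w0 dbc.
apply: (is_derive_eq (is_derive_mul dn di)).
have gE : g s = (f s - f1 s * cexp (- s) / c%:C) / branch a e (cexp s) by [].
rewrite gE; move: fode; rewrite -/(sol_fst k0 lam s) -/(sol_fst k1 lam s) -/f -/f1.
rewrite uE; move: wz w0 den0 z0 cC; rewrite /ratc.
move: (cexp s) (branch a e (cexp s)) (f s) (f1 s) a%:C c%:C => z w x y A C.
rewrite mulf_eq0 negb_or => wz w0 /andP[z1 zA] z0 C0 ode.
(* As w is nonzero, z avoids the zeros - 1 and a of the numerator, and the equation can be solved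
   for the second derivative. *)
have zz : (z + 1) * (z - A) != 0.
  apply: contra w0 => /eqP n0; rewrite -sqrf_eq0 wz n0 mul0r//.
have [zp zm] : z + 1 != 0 /\ z - A != 0.
  by move: zz; rewrite mulf_eq0 negb_or => /andP.
have E : f2 = y + (A - 1) * (z ^+ 2 + A) * z ^+ 2 * (y / z - C * x) /
   ((z - 1) * (z + 1) * (z - A) * (z + A)).
  have d0 : (1 - z^-1 ^+ 2) * (1 - A ^+ 2 * z^-1 ^+ 2) != 0.
    have -> : (1 - z^-1 ^+ 2) * (1 - A ^+ 2 * z^-1 ^+ 2) =
      (z - 1) * (z + 1) * (z - A) * (z + A) / z ^+ 4 by field.
    by rewrite !mulf_neq0 ?invr_eq0 ?expf_neq0.
  apply: (addIr (- y)); apply: (mulfI d0); rewrite ode.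
  by field; rewrite ?z0 ?z1 ?zp ?zm ?zA.
(* Splitting off one factor 1/w leaves w^2, which [wz] replaces by a rational function of z. *)
rewrite E; have -> : (x - y * z^-1 / C) * (- (2 * (A - 1) * (z ^+ 2 + A) / ((z -
  1) * (z + A)) ^+ 2 / (2 * w) * z) / w ^+ 2) =
   (x - y * z^-1 / C) * (- (2 * (A - 1) * (z ^+ 2 + A) / ((z - 1) * (z + A)) ^+ 2
     / 2 * z) / w ^+ 2) / w.
  by field; rewrite ?w0 ?z0 ?z1 ?zA ?C0.
rewrite wz; field.
by rewrite ?w0 ?z0 ?z1 ?zA ?C0 ?zp ?zm.
Qed.

End FrobeniusSystem.

(** * Trace of the monodromy about an end *)

Section EndMonodromy.
Context {R : realType}.
Implicit Types (z w v e s : R[i]) (a c : R).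

Lemma closed_disc (r : R) : closed [set z : R[i] | normc z <= r].
Proof.
rewrite -openC openE => z /= /negP; rewrite -ltNge => rz.
apply/near_complexP; exists (normc z - r); first by rewrite subr_gt0.
move=> v vz /=; apply/negP; rewrite -ltNge.
have := normc_triangle v (z - v); rewrite [v + _]addrC subrK normcB; lra.
Qed.

(** Neighbourhoods of infinity on the sphere are given by complements of closed compact sets. The
    disc is a closed part of the image of a square. *)
Lemma compact_disc (r : R) : compact [set z : R[i] | normc z <= r].
Proof.
pose box := [set` `[- r, r]] `*` [set` `[- r, r]] : set (R * R).
have cbox : compact box by apply: compact_setX; exact: segment_compact.
pose h (q : R * R) : R[i] := q.1 +i* q.2.
have ch : {within box, continuous h}.
  apply: continuous_subspaceT => q; apply: cvg_ReIm => /=.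
    exact: cvg_fst.
  exact: cvg_snd.
apply: subclosed_compact (@closed_disc r) (continuous_compact ch cbox) _.
move=> z /= zr; exists (Re z, Im z); last by case: z {zr}.
by split; rewrite /= in_itv/= -ler_norml; apply: le_trans zr;
  [exact: Re_le_normc|exact: Im_le_normc].
Qed.

(** The condition on z is vacuous at infinity, so the end itself belongs to the set; the one on w
    singles out a sheet and excludes w = 0. *)
Definition end_nbhd (r : R) e : set (sphere R * sphere R) :=
  [set q | (forall z, q.1 = Some z -> r < normc z) /\
           exists2 w, q.2 = Some w & normc (w - e) < 1 / 2].

Lemma nbhs_end_nbhd r e : nbhs ((None, Some e) :
  sphere R * sphere R) (end_nbhd r e).
Proof.
exists ([set q : sphere R | forall z, q = Some z -> r < normc z],
        Some @` [set w | normc (w - e) < 1 / 2]) => /=; last first.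
  by move=> [q1 q2] /= [h [w we <-]]; split => //; exists w.
split.
  exists [set z : R[i] | normc z <= r].
    by split; [exact: compact_disc|exact: closed_disc].
  move=> q [[z zr <-]|->//] z' [<-].
  by rewrite ltNge; exact/negP.
apply: one_point_compactification_some_nbhs; apply/near_complexP.
by exists (1 / 2) => //; rewrite divr_gt0.
Qed.

Lemma invertible_conj_trace (K Phi : 'M[R[i]]_2) d1 d2 : d1 != 0 -> d2 != 0 ->
  \det K != 0 -> mx2 d1 0 0 d2 *m (K *m Phi) = K -> \tr Phi = d1^-1 + d2^-1.
Proof.
move=> d10 d20 K0 DK.
have KU : K \in unitmx by rewrite unitmxE unitfE.
have E : mx2 d1^-1 0 0 d2^-1 *m mx2 d1 0 0 d2 = 1%:M.
  apply/matrixP => i j; rewrite !mxE !big_ord_recl big_ord0 !mxE /=.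
  by case: i => -[|[|//]] ?; case: j => -[|[|//]] ?;
    rewrite /= ?mulr0 ?mul0r ?addr0 ?add0r ?mulVf.
have KP : K *m Phi = mx2 d1^-1 0 0 d2^-1 *m K.
  by rewrite -[in RHS]DK mulmxA E mul1mx.
have -> : Phi = invmx K *m (mx2 d1^-1 0 0 d2^-1 *m K).
  by rewrite -KP mulmxA mulVmx// mul1mx.
rewrite mxtrace_mulC -mulmxA mulmxV// mulmx1 /mxtrace.
by rewrite !big_ord_recl big_ord0 !mxE /= addr0.
Qed.

Lemma det_mx2 (x y z t : R[i]) : \det (mx2 x y z t) = x * t - y * z.
Proof.
rewrite (expand_det_row _ ord0) !big_ord_recl big_ord0 /cofactor !det_mx11 !mxE /=.
by rewrite expr0 expr1 mul1r addr0 mulN1r mulrN.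
Qed.

End EndMonodromy.

Section MonodromyTrace.
Context {R : realType}.
Implicit Types (z w v e s : R[i]) (a c : R).
Context (T : topologicalType) (p : T -> sphere R * sphere R).
Context (F : T -> 'M[R[i]]_2).

(** Around each t another local function of z represents [F]; constancy is compared on overlaps
    only, along a lift and a logarithm that are both continuous. *)
Lemma wronskian_along_path a c e (r : R) (f g : R[i] -> R[i])
    (lift : R -> T) (s : R -> R[i]) (j : 'I_2) : e ^+ 2 = 1 ->
  covering_map (surfaceM a) p -> weierstrass_solution p F c ->
  (forall s, normc (cexp (- s)) < r ->
     (\forall v \near cexp s, [/\ (v - 1) * (v + a%:C) != 0,
        branch a e v ^+ 2 = ratc a v & normc (branch a e v - e) < 1 / 2]) ->
     is_derive s 1 f (cexp s * c%:C * (f s - branch a e (cexp s) * g s)) /\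
     is_derive s 1 g (cexp s * c%:C * (f s / branch a e (cexp s) - g s))) ->
  {within `[(0 : R), 1]%classic, continuous lift} ->
  {within `[(0 : R), 1]%classic, continuous s} ->
  (forall t, t \in `[0, 1] -> normc (cexp (- s t)) < r /\
     exists2 w, p (lift t) = (Some (cexp (s t)), Some w) & normc (w - e) < 1 / 2) ->
  f (s 1) * F (lift 1) 1 j - g (s 1) * F (lift 1) 0 j =
  f (s 0) * F (lift 0) 1 j - g (s 0) * F (lift 0) 0 j.
Proof.
move=> e2 pcov Fsol fgd liftc sc ps.
apply: (@locally_constant_segment R _
  (fun t => f (s t) * F (lift t) 1 j - g (s t) * F (lift t) 0 j)) => t tI.
have [ur [w pt we]] := ps t tI.
have [Fh [_ Fhd]] := local_solution e2 pcov Fsol pt we.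
pose P v := [/\ (v - 1) * (v + a%:C) != 0,
        branch a e v ^+ 2 = ratc a v & normc (branch a e v - e) < 1 / 2].
(* The system is known at q only if [P] holds on a whole neighbourhood of exp q. *)
have PP : nbhs (cexp (s t)) [set v | nbhs v P].
  by apply: nbhs_interior; apply: filterS Fhd => v [].
have cN : {for s t, continuous (fun s => cexp (- s))}.
  apply: (is_derive_continuous (d := - cexp (- s t))).
  by apply: (is_derive_compc _ (is_derive_cexp _)); rewrite mulrN1.
have fg : \forall q \near s t,
    is_derive (q : R[i]) 1 f (cexp q * c%:C * (f q - branch a e (cexp q) * g q)) /\
    is_derive (q : R[i]) 1 g (cexp q * c%:C * (f q / branch a e (cexp q) - g q)).
  have n1 : \forall q \near s t, nbhs (cexp q) P.
    have H := is_derive_continuous (is_derive_cexp (s t)).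
    have /near_complexP[d d0 dP] := PP.
    by move/cvg_complexP : H => /(_ _ d0); apply: filterS => q /dP.
  have n2 : \forall q \near s t, normc (cexp (- q)) < r.
    move/cvg_complexP : cN => /(_ (r - normc (cexp (- s t)))).
    rewrite subr_gt0 => /(_ ur); apply: filterS => q.
    rewrite ltrBrDr; apply: le_lt_trans.
    by have := normc_triangle (cexp (- q) - cexp (- s t)) (cexp (- s t));
      rewrite subrK.
  near=> q; apply: fgd; near: q; [exact: n2|exact: n1].
have [V [d [Vx d0 Vd]]] := wronskian_locally_constant j e2 pcov Fsol pt we fg.
have lV : \forall u \near t, u \in `[0, 1] -> V (lift u).
  by move/subspace_continuousP : liftc => /(_ t tI) /(_ _ Vx).
have sd : \forall u \near t, u \in `[0, 1] -> normc (s u - s t) < d.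
  move/subspace_continuousP : sc => /(_ t tI) st.
  have H : nbhs (s t) [set v | normc (v - s t) < d] by apply/near_complexP;
    exists d.
  exact: (st _ H).
near=> u => uI; apply: Vd.
- by move: uI; near: u.
- by move: uI; near: u.
- by have [_ [w' -> _]] := ps u uI.
Unshelve. all: by end_near. Qed.

(** On a closed loop the moduli of z at both ends agree, so ln rho returns to its value and only the
    argument changes. *)
Lemma winds_once_log (g : R -> sphere R * sphere R) : winds_once g ->
  exists s : R -> R[i], [/\ {within `[(0 : R), 1]%classic, continuous s},
    forall t, t \in `[0, 1] -> (g t).1 = Some (cexp (s t)) &
    g 0 = g 1 -> s 1 = s 0 + (2 * pi)%:C * 'i \/ s 1 = s 0 - (2 * pi)%:C * 'i].
Proof.
move=> [rho [phi [crho cphi gE phi2]]].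
pose s (t : R) : R[i] := ln (rho t) +i* phi t.
have sE t : t \in `[0, 1] -> (g t).1 = Some (cexp (s t)).
  rewrite in_itv/= => /gE[rho0 ->]; rewrite /cexp /= lnK//.
exists s; split => //.
  apply/subspace_continuousP => t tI.
  have [rho0 _] : 0 < rho t /\ (g t).1 = Some ((rho t)%:C * expi (phi t)).
    by apply: gE; move: tI; rewrite /= in_itv.
  apply: cvg_ReIm => /=.
    apply: continuous_cvg; first exact: continuous_ln.
    by move/subspace_continuousP : crho; apply.
  by move/subspace_continuousP : cphi; apply.
move=> g01.
have I0 : (0 : R) \in `[0, 1] by rewrite in_itv/= lexx ler01.
have I1 : (1 : R) \in `[0, 1] by rewrite in_itv/= lexx ler01.
have : cexp (s 0) = cexp (s 1).
  have := sE 0 I0; rewrite g01 (sE 1 I1).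
  by move/(congr1 (odflt (0 : R[i]))).
move/(congr1 (@normc R)); rewrite !normc_cexp /= => /expR_inj ln01.
rewrite /s -ln01.
have : (phi 1 - phi 0 == 2 * pi) || (phi 1 - phi 0 == - (2 * pi)).
  by rewrite -eqr_norm2 phi2 ger0_norm// mulr_ge0 ?pi_ge0.
case/orP => /eqP /(canRL (subrK _)) ->; [left|right]; apply/eqP;
  by rewrite eq_complex /= !(mulr0, mul0r, mulr1, subr0, addr0, oppr0) addrC !eqxx.
Qed.

End MonodromyTrace.

Section EndTrace.
Context {R : realType}.
Implicit Types (z w v e s m : R[i]) (a c : R).

Lemma cexp_pi : cexp (pi%:C * 'i : R[i]) = -1.
Proof.
rewrite (_ : pi%:C * 'i = pi *i); last first.
  by apply/eqP; rewrite eq_complex /= !(mulr0, mul0r, mulr1, subr0, addr0) !eqxx.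
by rewrite cexp_imag /expi cospi sinpi -(rmorphN1 (real_complex R)).
Qed.

(** A period d of exp leaves u = exp (- s) unchanged, so only the factor exp (lam s) reacts. *)
Lemma sol_shift (k0 : R[i] -> R[i]) lam s d : cexp d = 1 ->
  sol_fst k0 lam (s + d) = cexp (lam * d) * sol_fst k0 lam s.
Proof.
move=> d1; rewrite /sol_fst opprD [cexp (- s - d)]cexpD cexpN.
by rewrite [cexp (- d)]cexpN d1 invr1 mulr1 -cexpN mulrDr cexpD mulrAC mulrC.
Qed.

Lemma sol_snd_shift a c e (k0 k1 : R[i] -> R[i]) lam s d : cexp d = 1 ->
  sol_snd a c e k0 k1 lam (s + d) = cexp (lam * d) * sol_snd a c e k0 k1 lam s.
Proof.
move=> d1; rewrite /sol_snd !sol_shift// opprD [cexp (- s - d)]cexpD.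
rewrite [cexp (- d)]cexpN [cexp (s + d)]cexpD d1 invr1 !mulr1 mulrA.
by congr (_ / _); rewrite mulrBr !mulrA.
Qed.

(** Here (1 + m) / 2 and (1 - m) / 2 times 2 pi i are pi i + m pi i and pi i - m pi i, and exp (pi
    i) = -1. The sum is even in d, so both orientations give the same trace. *)
Lemma cexp_exponent_trace m d : d = pi%:C * 'i + pi%:C * 'i \/
    d = - (pi%:C * 'i + pi%:C * 'i) ->
  (cexp ((1 + m) / 2 * d))^-1 + (cexp ((1 - m) / 2 * d))^-1 =
  - (cexp (m * (pi%:C * 'i)) + cexp (- (m * (pi%:C * 'i)))).
Proof.
move=> dE; set q := pi%:C * 'i in dE *.
have qp : cexp q = -1 := cexp_pi.
have qn : cexp (- q) = -1 by rewrite cexpN qp invrN1.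
rewrite -!cexpN; clearbody q; case: dE => ->.
  have -> : - ((1 + m) / 2 * (q + q)) = - q + - (m * q) by field.
  have -> : - ((1 - m) / 2 * (q + q)) = - q + m * q by field.
  by rewrite !cexpD qn !mulN1r opprD addrC.
have -> : - ((1 + m) / 2 * - (q + q)) = q + m * q by field.
have -> : - ((1 - m) / 2 * - (q + q)) = q + - (m * q) by field.
by rewrite !cexpD qp !mulN1r opprD.
Qed.

Context (T : topologicalType) (p : T -> sphere R * sphere R).
Context (F : T -> 'M[R[i]]_2).

(** For K = P 0 F (lift 0) three identities combine: P 1 F (lift 1) = K by constancy of the
    Wronskians, P 1 = D P 0 with D diagonal by the shift of s, and F (lift 1) = F (lift 0) Phi by
    the deck transformation. Hence D K Phi = K. *)
Lemma end_monodromy_trace a c m e : c != 0 -> e ^+ 2 = 1 ->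
  m ^+ 2 = (1 - 4 * c * (a - 1))%:C -> m != 0 ->
  (forall k, (0 < k)%N -> k%:R != m /\ k%:R != - m) ->
  covering_map (surfaceM a) p -> weierstrass_solution p F c ->
  exists2 U, nbhs ((None, Some e) : sphere R * sphere R) U &
    forall g Phi, is_loop (surfaceM a `&` U) g -> winds_once g ->
      monodromy p F g Phi ->
      \tr Phi = - (cexp (m * (pi%:C * 'i)) + cexp (- (m * (pi%:C * 'i)))).
Proof.
move=> c0 e2 m2 m0 mN pcov Fsol.
pose lp := (1 + m) / 2; pose lm := (1 - m) / 2.
have c4 : c%:C * (a%:C - 1) = (1 - m ^+ 2) / 4.
  by rewrite m2 !(rmorphB, rmorphM, rmorph1, rmorph_nat) /=; field.
have [r1 [k0p [k1p [r10 [k0p0 k1p0] [ck0p ck1p] sysp]]]] :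
    exists (r : R) (k0 k1 : R[i] -> R[i]), _ :=
  @frobenius_system R a c lp c0 ltac:(by rewrite c4 /lp; field)
    ltac:(by move=> k /mN[+ _]; rewrite (_ : 2 * lp - 1 = m)// /lp; field).
have [r2 [k0m [k1m [r20 [k0m0 k1m0] [ck0m ck1m] sysm]]]] :
    exists (r : R) (k0 k1 : R[i] -> R[i]), _ :=
  @frobenius_system R a c lm c0 ltac:(by rewrite c4 /lm; field)
    ltac:(by move=> k /mN[_]; rewrite (_ : 2 * lm - 1 = - m)// /lm; field).
(* Up to factors that never vanish, [br] at u = exp (- s 0) is the determinant of the matrix P 0
   below. Its value lp - lm = m at u = 0 is nonzero, and [rb] keeps u where it stays so. *)
pose br u := k0m u * k1p u - k0p u * k1m u.
have br0 : br 0 = m by rewrite /br k0m0 k1p0 k0p0 k1m0 /lp /lm; field.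
have [rb rb0 brb] : exists2 rb : R, 0 < rb & forall u, normc u < rb -> br u != 0.
  have cbr : br @ (0 : R[i]) --> br 0.
    exact: cvgB (cvgM ck0m ck1p) (cvgM ck0p ck1m).
  have m1 : 0 < normc m by rewrite normc_gt0.
  move/cvg_complexP : cbr => /(_ _ m1)/near_complexP[d d0 dP].
  exists d => // u ud; apply/eqP => u0; have := dP u; rewrite subr0 => /(_ ud).
  by rewrite u0 br0 sub0r normc_opp ltxx.
pose r := Num.min r1 (Num.min r2 rb).
have r0 : 0 < r by rewrite /r !lt_min r10 r20.
exists (end_nbhd r^-1 e); first exact: nbhs_end_nbhd.
move=> g Phi [[_ gM] g01] gw [tau [_ [lift [[liftc _] liftg lift1]]] Ftau].
have [s [sc gs s01]] := winds_once_log gw.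
have ps t : t \in `[0, 1] -> normc (cexp (- s t)) < r /\
     exists2 w, p (lift t) = (Some (cexp (s t)), Some w) & normc (w - e) < 1 / 2.
  move=> tI; have [_ [zr [w wE we]]] := gM t tI; have g1 := gs t tI; split.
    rewrite cexpN normcV -[r]invrK ltf_pV2 ?posrE ?invr_gt0//; first exact: zr.
    by rewrite normc_gt0 cexp_neq0.
  by exists w => //; rewrite liftg//; case: (g t) g1 wE => q1 q2 /= -> ->.
have I0 : (0 : R) \in `[0, 1] by rewrite in_itv/= lexx ler01.
have [u0 [w0 pw we]] := ps 0 I0.
have F0 : \det (F (lift 0)) = 1 by have [] := Fsol.
have F1 : F (lift 1) = F (lift 0) *m Phi by rewrite lift1.
pose d := s 1 - s 0.
have dE : d = pi%:C * 'i + pi%:C * 'i \/ d = - (pi%:C * 'i + pi%:C * 'i).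
  have E2 : (2 * pi)%:C * 'i = pi%:C * 'i + pi%:C * 'i :> R[i].
    by rewrite rmorphM rmorph_nat /= -mulrDl mulr_natl mulr2n.
  by case: (s01 g01) => sE; [left|right]; rewrite /d sE E2 addrC addKr.
have d1 : cexp d = 1.
  by case: dE => ->; rewrite ?cexpN cexpD cexp_pi mulrNN mulr1 ?invr1.
have sE : s 1 = s 0 + d by rewrite /d addrC subrK.
pose fp := sol_fst k0p lp; pose gp := sol_snd a c e k0p k1p lp.
pose fm := sol_fst k0m lm; pose gm := sol_snd a c e k0m k1m lm.
(* The rows (- g, f) make the entries of P t times F exactly the Wronskians with the columns of
   [F]. *)
pose P t := mx2 (- gp (s t)) (fp (s t)) (- gm (s t)) (fm (s t)).
have KE : P 1 *m F (lift 1) = P 0 *m F (lift 0).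
  have rr1 : r <= r1 by rewrite /r ge_min lexx.
  have rr2 : r <= r2 by rewrite /r !ge_min lexx orbT.
  have Wp j := wronskian_along_path j e2 pcov Fsol
    (fun s ur => sysp e s e2 (lt_le_trans ur rr1)) liftc sc ps.
  have Wm j := wronskian_along_path j e2 pcov Fsol
    (fun s ur => sysm e s e2 (lt_le_trans ur rr2)) liftc sc ps.
  apply/matrixP => i j; rewrite !mxE !big_ord_recl !big_ord0 !mxE /= !addr0.
  have -> : fintype.lift ord0 ord0 = 1 :> 'I_2 by exact: val_inj.
  case: i => -[|[|//]] ? /=; rewrite ![- _ * _ + _]addrC !mulNr;
    [exact: Wp|exact: Wm].
have PD : P 1 = mx2 (cexp (lp * d)) 0 0 (cexp (lm * d)) *m P 0.
  rewrite /P sE /fp /fm /gp /gm !sol_shift// !sol_snd_shift//.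
  apply/matrixP => i j; rewrite !mxE !big_ord_recl !big_ord0 !mxE /= !addr0.
  by case: i => -[|[|//]] ?; case: j => -[|[|//]] ?;
    rewrite /= ?mul0r ?addr0 ?add0r ?mulrN.
have detP : \det (P 0) != 0.
  rewrite det_mx2.
  have -> : - gp (s 0) * fm (s 0) - fp (s 0) * - gm (s 0) =
     cexp ((lp + lm) * s 0) * cexp (- s 0) * br (cexp (- s 0)) / (c%:C * branch a
       e (cexp (s 0))).
    rewrite /gp /gm /fp /fm /sol_snd /sol_fst /br (mulrDl lp lm) [cexp (_ +
      _)]cexpD.
    have /surfaceM_Some[_ wz] : surfaceM a (Some (cexp (s 0)), Some w0).
      by have [_ <- _] := pcov; exists (lift 0).
    rewrite (branchE e2 wz we).
    have w00 := branch_neq0 e2 we.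
    have cC : c%:C != 0 by rewrite (inj_eq (@complexI R)).
    move: c%:C cC w0 w00 {wz we pw} => C C0 w w0.
    move: (cexp (- s 0)) (cexp (lp * s 0)) (cexp (lm * s 0)) (k0p (cexp (- s 0)))
      (k0m (cexp (- s 0))) (k1p (cexp (- s 0))) (k1m (cexp (- s 0))) => x1 x2 x3
      x4 x5 x6 x7.
    by field; rewrite ?w0 ?C0.
  have /surfaceM_Some[_ wz] : surfaceM a (Some (cexp (s 0)), Some w0).
    by have [_ <- _] := pcov; exists (lift 0).
  have cw : c%:C * w0 != 0.
    by rewrite mulf_neq0 ?(branch_neq0 e2 we) ?(inj_eq (@complexI R)).
  have bu : br (cexp (- s 0)) != 0.
    by apply: brb; apply: lt_le_trans u0 _; rewrite /r !ge_min lexx !orbT.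
  rewrite (branchE e2 wz we) mulf_neq0 ?invr_eq0// mulf_neq0// mulf_neq0//;
    exact: cexp_neq0.
rewrite -(cexp_exponent_trace _ dE) -/lp -/lm.
apply: (@invertible_conj_trace _ (P 0 *m F (lift 0))); rewrite ?cexp_neq0//.
  by rewrite det_mulmx F0 mulr1.
by rewrite -[in RHS]KE PD F1 !mulmxA.
Qed.

End EndTrace.

(** * Conjugacy in SU(1,1) *)

Section SU11Classification.
Context {R : realType}.
Implicit Types (A V B : 'M[R[i]]_2) (p q u w : R[i]) (s t x y : R).

Lemma mulmx2 (x1 y1 z1 t1 x2 y2 z2 t2 : R[i]) :
  mx2 x1 y1 z1 t1 *m mx2 x2 y2 z2 t2 =
  mx2 (x1 * x2 + y1 * z2) (x1 * y2 + y1 * t2)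
      (z1 * x2 + t1 * z2) (z1 * y2 + t1 * t2).
Proof.
apply/matrixP => i j; rewrite !mxE !big_ord_recl big_ord0 !mxE /= addr0.
by case: i => -[|[|//]] ?; case: j => -[|[|//]] ?.
Qed.

Lemma SU11_normE p q : `|p| ^+ 2 - `|q| ^+ 2 = 1 <->
  Re p ^+ 2 + Im p ^+ 2 - (Re q ^+ 2 + Im q ^+ 2) = 1.
Proof.
rewrite -!add_Re2_Im2 -rmorphB -[1 in X in X <-> _](rmorph1 (real_complex R)).
by split => [/complexI//|->].
Qed.

Lemma SU11_conj A V B : SU11 V -> A *m V = V *m B -> conj_SU11 A B.
Proof.
move=> SV AV; exists V => //; rewrite -AV mulmxK//.
have [p [q [-> pq]]] := SV.
have dE : p * p^* - q * q^* = `|p| ^+ 2 - `|q| ^+ 2 by rewrite !normcE !sqr_sqrtc.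
by rewrite unitmxE det_mx2 dE pq unitr1.
Qed.

Lemma eq_mx2 (x1 y1 z1 t1 x2 y2 z2 t2 : R[i]) :
  x1 = x2 -> y1 = y2 -> z1 = z2 -> t1 = t2 -> mx2 x1 y1 z1 t1 = mx2 x2 y2 z2 t2.
Proof. by move=> -> -> -> ->. Qed.

(** The sign condition on sin t and Im p selects t against - t: it makes the eigenvector of exp (i
    t) positive for |x|^2 - |y|^2, so that it can be the first column of a matrix in SU(1,1). *)
Lemma SU11_elliptic p q t : `|p| ^+ 2 - `|q| ^+ 2 = 1 ->
  Re p = cos t -> 0 <= sin t * Im p -> sin t != 0 ->
  conj_SU11 (mx2 p q q^* p^*) (rotation t).
Proof.
case: p q => al be [qa qb] /SU11_normE /= pq alE sb s0; rewrite {}alE in pq *.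
rewrite /rotation /expi cosN sinN.
have := cos2Dsin2 t; move: (sin t) (cos t) sb s0 pq => s C sb s0 pq Cs.
have qq : qa ^+ 2 + qb ^+ 2 = be ^+ 2 - s ^+ 2 by lra.
have [k kE] : exists k : R, k ^+ 2 * (2 * s * (s + be)) = 1.
  have d0 : 0 < 2 * s * (s + be).
    have : 0 < s ^+ 2 by rewrite exprn_even_gt0.
    nra.
  exists (Num.sqrt (2 * s * (s + be)))^-1.
  by rewrite exprVn sqr_sqrtr ?ltW// mulVf// gt_eqF.
have kq : k * (qa ^+ 2 + qb ^+ 2) = k * (be ^+ 2 - s ^+ 2) by rewrite qq.
have kkq : k * (k * (qa ^+ 2 + qb ^+ 2)) =
  k * (k * (be ^+ 2 - s ^+ 2)) by rewrite qq.
pose X : R[i] := (k * (s + be)) +i* 0; pose Y : R[i] := (- (k * qb)) +i* (k * qa).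
apply: (@SU11_conj _ (mx2 X Y Y^* X^*)).
  by exists X, Y; split => //; apply/SU11_normE; rewrite /=; lra.
rewrite !mulmx2; apply: eq_mx2; rewrite /X /Y; simpc; congr (_ +i* _); lra.
Qed.

Lemma SU11_hyperbolic p q s : `|p| ^+ 2 - `|q| ^+ 2 = 1 ->
  Re p = cosh s -> s != 0 -> conj_SU11 (mx2 p q q^* p^*) (boost s).
Proof.
case: p q => al be [qa qb] /SU11_normE /= pq alE s0; rewrite {}alE in pq *.
have hs : cosh s ^+ 2 - sinh s ^+ 2 = 1.
  rewrite /cosh /sinh expRN; have e0 : expR s != 0 by rewrite gt_eqF ?expR_gt0.
  by field.
have sh0 : sinh s != 0.
  rewrite /sinh mulf_neq0 ?invr_eq0// subr_eq0.
  by apply: contra s0 => /eqP/expR_inj ss; apply/eqP; lra.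
rewrite /boost; move: (sinh s) (cosh s) sh0 hs pq => h C h0 hC pq.
have qq : qa ^+ 2 + qb ^+ 2 = be ^+ 2 + h ^+ 2 by lra.
have d0 : h ^+ 2 + be ^+ 2 != 0.
  by rewrite gt_eqF// ltr_pwDl ?sqr_ge0// exprn_even_gt0.
have [ua [ub [u1 uq]]] : exists ua ub : R, ua ^+ 2 + ub ^+ 2 = 1 /\
  (ua +i* ub) ^+ 2 * (h +i* (- be)) = qa +i* qb.
  pose w : R[i] := (qa +i* qb) / (h +i* (- be)).
  have hb0 : h +i* (- be) != 0 by rewrite eq_complex /= negb_and h0.
  have uw := sqr_sqrtc w; case: (sqrtc w) uw => ua ub uw.
  exists ua, ub; split; last by rewrite uw /w divfK.
  have n1 : normc ((ua +i* ub) ^+ 2) = 1.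
    rewrite uw /w normcM normcV /= sqrrN qq [be ^+ 2 + _]addrC divff//.
    by rewrite sqrtr_eq0 -ltNge lt_neqAle eq_sym d0 addr_ge0 ?sqr_ge0.
  move: n1; rewrite normcX => /eqP; rewrite expr2 -expr2 pexpr_eq1 ?normc_ge0//.
  by move=> /eqP/(congr1 (fun x => x ^+ 2));
    rewrite /= sqr_sqrtr ?addr_ge0 ?sqr_ge0// expr1n.
move: uq; rewrite expr2; simpc => -[qaE qbE].
pose x : R[i] := (ua + ub * (be / (2 * h))) +i* (ub - ua * (be / (2 * h))).
pose y : R[i] := (- (ub * (be / (2 * h)))) +i* (ua * (be / (2 * h))).
have kh : be / (2 * h) * h = be / 2 by field.
apply: (@SU11_conj _ (mx2 x y y^* x^*)).
  exists x, y; split => //; apply/SU11_normE; rewrite /= -[RHS]u1; ring.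
(* The multiples of |u|^2 = 1 and of k h = be / 2 collected here make the entrywise identities
   linear in the remaining monomials. *)
move: (be / (2 * h)) kh @x @y => k kh x y.
have uM v : v * (ua ^+ 2 + ub ^+ 2) = v by rewrite u1 mulr1.
have [kh1 kh2] : ua * (k * h) = ua * (be / 2) /\ ub * (k * h) = ub * (be / 2).
  by rewrite kh.
have [] := (uM (ua * k * h), uM (ub * k * h)).
have [] := (uM (ua * k * be), uM (ub * k * be)).
have [] := (uM (ua * h), uM (ub * h)).
have [] := (uM (ua * be), uM (ub * be)).
rewrite !mulmx2 -qaE -qbE => *.
apply: eq_mx2; rewrite /x /y; simpc; congr (_ +i* _); lra.
Qed.

End SU11Classification.

(** * The type of an element of SU(1,1) read off its trace *)

Section MonodromyClassification.
Context {R : realType}.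
Implicit Types (A : 'M[R[i]]_2) (x y : R).

(** Removing the integer part of x changes the sine at most by a sign and leaves an angle strictly
    between 0 and pi. *)
Lemma sin_natpi_neq0 x : 0 < x -> ~ (exists2 n : nat, (0 < n)%N & x = n%:R) ->
  sin (x * pi) != 0.
Proof.
move=> x0 xN; pose n := Num.truncn x.
have /andP[nx xn] : n%:R <= x < n.+1%:R by rewrite truncn_itv// ltW.
have nxN : n%:R != x.
  apply/eqP => nE; case: (posnP n) => [n0|n0]; first by move: x0;
    rewrite -nE n0 ltxx.
  by apply: xN; exists n.
have s0 : 0 < sin ((x - n%:R) * pi).
  apply: sin_gt0_pi; rewrite mulr_gt0 ?pi_gt0//=; last first.
    by rewrite subr_gt0 lt_neqAle nxN.
  by rewrite gtr_pMl ?pi_gt0// ltrBlDr addrC natr1.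
have -> : x * pi = (x - n%:R) * pi + n%:R * pi by rewrite -mulrDl subrK.
move: (_ * pi) s0 => z z0; elim: (n) => [|k IH];
  first by rewrite mul0r addr0 gt_eqF.
by rewrite -natr1 mulrDl mul1r addrA sinDpi oppr_eq0.
Qed.

Lemma cexp_trace_real x :
  - (cexp (x%:C * (pi%:C * 'i)) + cexp (- (x%:C * (pi%:C * 'i)))) =
  (- (2 * cos (x * pi)))%:C :> R[i].
Proof.
have xE : x%:C * (pi%:C * 'i) = (x * pi) *i :> R[i].
  by rewrite mulrA -rmorphM; simpc.
have -> : - (x%:C * (pi%:C * 'i)) = (- (x * pi)) *i :> R[i].
  by rewrite xE; simpc.
rewrite xE !cexp_imag /expi cosN sinN.
by apply/eqP; rewrite eq_complex /=; apply/andP; split; apply/eqP; ring.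
Qed.

Lemma cexp_trace_imag y :
  - (cexp (y *i * (pi%:C * 'i)) + cexp (- (y *i * (pi%:C * 'i)))) =
  (- (2 * cosh (y * pi)))%:C :> R[i].
Proof.
have yE : y *i * (pi%:C * 'i) = (- (y * pi))%:C :> R[i] by simpc.
rewrite yE -rmorphN /= opprK !cexp_real -rmorphD -rmorphN /=.
by congr (_%:C); rewrite /cosh; field.
Qed.

Lemma SU11_trace p q (x : R) : \tr (mx2 p q q^* p^*) = (- (2 * x))%:C ->
  Re p = - x.
Proof.
rewrite /mxtrace !big_ord_recl big_ord0 !mxE /= addr0 addcJ.
rewrite -(rmorph_nat (real_complex R)) -rmorphM => /complexI /= E.
by lra.
Qed.

(** Re p = - cos x lies strictly between - 1 and 1; the angle is acos (Re p) or 2 pi - acos (Re p),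
    according to the sign of Im p. *)
Lemma SU11_elliptic_trace A x : SU11 A -> sin x != 0 ->
  \tr A = (- (2 * cos x))%:C -> elliptic A.
Proof.
move=> [p [q [-> pq]]] sx /SU11_trace pE.
have sc := cos2Dsin2 x.
have al1 : Re p ^+ 2 < 1.
  have : 0 < sin x ^+ 2 by rewrite exprn_even_gt0.
  by rewrite pE sqrrN; lra.
have alI : -1 <= Re p <= 1 by nra.
have /andP[t0 tpi] := proj1 (acos_def alI); have ct := proj2 (acos_def alI).
have st : 0 < sin (acos (Re p)) by rewrite sin_acos// sqrtr_gt0 subr_gt0.
move: (acos _) t0 tpi ct st => t t0 tpi ct st.
have pi0 := pi_gt0 R.
have tp : 0 < t.
  by rewrite lt_neqAle t0 andbT; apply/eqP => tE; move: st; rewrite -tE sin0 ltxx.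
case: (leP 0 (Im p)) => [i0|i0].
  exists t; first by rewrite t0 /=; lra.
  by apply: SU11_elliptic; rewrite ?ct ?gt_eqF// mulr_ge0// ltW.
exists (2 * pi - t); first by apply/andP; split; lra.
have E : 2 * pi - t = - t + pi *+ 2 by rewrite mulr2n; ring.
apply: SU11_elliptic => //.
- by rewrite E cosD2pi cosN.
- by rewrite E sinD2pi sinN nmulr_rge0 ?oppr_lt0 ?ltW.
- by rewrite E sinD2pi sinN oppr_eq0 gt_eqF.
Qed.

(** The trace is negative, so the classification is applied to - A, which produces the second
    alternative of [hyperbolic]. *)
Lemma SU11_hyperbolic_trace A s : SU11 A -> s != 0 ->
  \tr A = (- (2 * cosh s))%:C -> hyperbolic A.
Proof.
move=> [p [q [-> pq]]] s0 /SU11_trace pE; exists s => //; right.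
have [] := @SU11_hyperbolic R (- p) (- q) s _ _ s0.
- by rewrite !normrN.
- by move: pE; case: (p) => ? ? /= ->; rewrite opprK.
move=> V SV VE; exists V => //.
have -> : mx2 p q q^* p^* = - mx2 (- p) (- q) (- q)^* (- p)^*.
  apply/matrixP => i j; rewrite !mxE !rmorphN.
  by case: i => -[|[|//]] ?; case: j => -[|[|//]] ?; rewrite /= opprK.
by rewrite VE mulmxN mulNmx.
Qed.

End MonodromyClassification.

Unset Implicit Arguments.

Theorem propositionA3 (R : realType) (a c : R) (m : R[i])
    (T : topologicalType) (p : T -> sphere R * sphere R)
    (F : T -> 'M[R[i]]_2) (f : sphere R * sphere R -> 'M[R[i]]_2)
    (ha : 1 < a) (hc : c != 0)
    (hp : universal_cover R (surfaceM a) p)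
    (hF : weierstrass_solution p F c)
    (hmon : SU11_monodromy p F a)
    (hf : face_of p F a f)
    (hm : square_root_of (1 - 4 * c * (a - 1)) m) :
  forall e : sphere R * sphere R, e = end_pos R \/ e = end_neg R ->
    (forall x : R, m = x%:C -> 0 < x ->
       ~ (exists2 n : nat, (0 < n)%N & x = n%:R) ->
       elliptic_end p F a e) /\
    (forall y : R, m = y *i -> y != 0 -> hyperbolic_end p F a e).
Proof.
move=> e0 eE; have [pcov _] := hp; have [m2 _ _] := hm.
(* Both ends are treated at once: only e^2 = 1 is used of the value e of w there. *)
have [e e2 {e0 eE}->] : exists2 e : R[i], e ^+ 2 = 1 & e0 = (None, Some e).
  by case: eE => ->; [exists 1|exists (-1)]; rewrite // ?expr1n ?sqrrN ?expr1n.
have su g Phi U : is_loop (surfaceM a `&` U) g -> monodromy p F g Phi -> SU11 Phi.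
  move=> [[gc gM] g01]; apply: hmon; split=> //; split=> // t tI.
  by have [] := gM t tI.
have realE k (z : R) : (k%:R : R[i]) = z%:C -> k%:R = z.
  by rewrite -(rmorph_nat (real_complex R)) => /complexI.
split=> [x mx x0 xN|y my y0].
  have [||U nU Utr] := @end_monodromy_trace R T p F a c m e hc e2 m2 _ _ pcov hF.
  - by rewrite mx -(rmorph0 (real_complex R)) (inj_eq (@complexI R)) gt_eqF.
  - move=> k k0; rewrite mx -rmorphN /=; split; apply/eqP => /realE kE.
      by apply: xN; exists k.
    by have : 0 <= k%:R :> R := ler0n _ _; rewrite kE oppr_ge0 leNgt x0.
  exists U => // g Phi gU gw gm; apply: (SU11_elliptic_trace (su _ _ _ gU gm)
    (sin_natpi_neq0 x0 xN)).
  by rewrite (Utr g Phi gU gw gm) mx cexp_trace_real.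
have [||U nU Utr] := @end_monodromy_trace R T p F a c m e hc e2 m2 _ _ pcov hF.
- by rewrite my eq_complex /= negb_and y0 orbT.
- move=> k k0; have kC : (k%:R : R[i]) = k%:R +i* 0.
    by rewrite -(rmorph_nat (real_complex R)).
  by rewrite kC my; split; rewrite eq_complex /= ?oppr0 negb_and pnatr_eq0 -lt0n k0.
exists U => // g Phi gU gw gm.
have yp : y * pi != 0 by rewrite mulf_neq0// gt_eqF ?pi_gt0.
apply: (SU11_hyperbolic_trace (su _ _ _ gU gm) yp).
by rewrite (Utr g Phi gU gw gm) my cexp_trace_imag.
Qed.
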